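(* For each $t\in\mathbb{R}$ let $N(t)\in\mathbb{N}_0$, let $x_1(t)<\dots<x_{N(t)}(t)$ be real numbers, and let $\omega_n(t)\in\mathbb{R}$, $\upsilon_n(t)\ge 0$ with $|\omega_n(t)|+\upsilon_n(t)>0$ for $n=1,\dots,N(t)$. Set $$\omega(\cdot,t)=\sum_{n=1}^{N(t)}\omega_n(t)\delta_{x_n(t)},\qquad \upsilon(\cdot,t)=\sum_{n=1}^{N(t)}\upsilon_n(t)\delta_{x_n(t)},$$ $$u(x,t)=\frac12\int_{\mathbb{R}}e^{-|x-s|}\,d\omega(s,t),\qquad x,t\in\mathbb{R},$$ $$\mu(B,t)=\upsilon(B,t)+\int_B |u(x,t)|^2+|u_x(x,t)|^2\,dx,\qquad B\subseteq\mathbb{R}\ \text{Borel},\ t\in\mathbb{R}.$$ If the pair $(u,\mu)$ is a global conservative multi-peakon solution of the Camassa--Holm equation, then the integrals $$\mathcal{I}_1=\int_{\mathbb{R}}d\omega(x,t)\qquad\text{and}\qquad \mathcal{I}_2=\int_{\mathbb{R}}u(x,t)\,d\omega(x,t)+\int_{\mathbb{R}}d\upsilon(x,t)$$ are independent of time $t\in\mathbb{R}$.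
   Context: Camassa--Holm equation: $u_t-u_{xxt}=2u_xu_{xx}-3uu_x+uu_{xxx}$. Global conservative solutions (in the sense of Holden and Raynaud). Let $\mathcal{D}$ be the set of pairs $(u,\mu)$ with $u\in H^1(\mathbb{R})$ real-valued and $\mu$ a finite non-negative Borel measure on $\mathbb{R}$ whose absolutely continuous part is $(u^2+u_x^2)\,dx$. Given $(u_0,\mu_0)\in\mathcal{D}$, put $y_0(\xi)=\sup\{x\in\mathbb{R}:\mu_0((-\infty,x))+x<\xi\}$, $U_0(\xi)=u_0(y_0(\xi))$, $H_0(\xi)=\xi-y_0(\xi)$. Let $(y,U,H)(t,\xi)$, $t\in\mathbb{R}$, be the unique global solution with initial data $(y_0,U_0,H_0)$ at $t=0$ of $$y_t=U,\qquad U_t=-Q,\qquad H_t=U^3-2PU,$$ where $$P(t,\xi)=\tfrac14\int_{\mathbb{R}}e^{-\mathrm{sgn}(\xi-\eta)(y(t,\xi)-y(t,\eta))}(U^2y_\xi+H_\xi)(t,\eta)\,d\eta,$$ $$Q(t,\xi)=-\tfrac14\int_{\mathbb{R}}\mathrm{sgn}(\xi-\eta)\,e^{-\mathrm{sgn}(\xi-\eta)(y(t,\xi)-y(t,\eta))}(U^2y_\xi+H_\xi)(t,\eta)\,d\eta,$$ understood as an ordinary differential equation for $(y-\mathrm{id},U,H)$ in $V\times H^1(\mathbb{R})\times V$, $V=\{f\in C_b(\mathbb{R}): f'\in L^2(\mathbb{R})\}$ (it is known that this solution exists for all $t\in\mathbb{R}$ and that $y(t,\cdot)$ is nondecreasing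 and onto). Define $T_t(u_0,\mu_0)=(u,\mu)$ by $u(x)=U(t,\xi)$ for any $\xi$ with $y(t,\xi)=x$, and $\mu=$ push-forward of $H_\xi(t,\xi)\,d\xi$ under $y(t,\cdot)$ (well-defined). A global conservative solution is a family $(u(\cdot,t),\mu(\cdot,t))\in\mathcal{D}$, $t\in\mathbb{R}$, with $(u,\mu)(t)=T_{t-s}\big((u,\mu)(s)\big)$ for all $s,t\in\mathbb{R}$. It is a multi-peakon solution if for some $s\in\mathbb{R}$ the measure $\mu(\cdot,s)$ is absolutely continuous and $u(x,s)=\sum_{n=1}^{N}p_ne^{-|x-q_n|}$ for some $N\in\mathbb{N}_0$ and $p_n,q_n\in\mathbb{R}$. *)

(* Defs.v *)
From HB Require Import structures.
From mathcomp Require Export all_boot all_order all_algebra.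
From mathcomp Require Export all_classical all_reals all_analysis.

Set Implicit Arguments.
Unset Strict Implicit.
Unset Printing Implicit Defensive.
Import Order.TTheory GRing.Theory Num.Theory.
Import numFieldNormedType.Exports.

Local Open Scope ring_scope.
Local Open Scope classical_set_scope.

(* Functions on the line that depend on time are curried with time first:
   [u t x] stands for u(x, t) and [y t xi] for y(t, xi). *)

Section Spaces.
Context {R : realType}.
Notation leb := (@lebesgue_measure R).

(* derive1 f is total: it is the classical derivative at the points where f is
   differentiable and a default value elsewhere.  A function in [ACloc] is the
   indefinite integral of derive1 f, so it is differentiable almost everywhere,
   the exceptional points form a null set, and derive1 f represents the weak
   derivative of f. *)
Definition ACloc (f : R -> R) : Prop :=
  locally_integrable setT (derive1 f) /\
  forall a b : R, a <= b -> f b - f a = \int[leb]_(x in `[a, b]) derive1 f x.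

Definition inL2 (f : R -> R) : Prop := f \in Lfun leb 2%:E.

(* Elements of H^1 are identified with their continuous representatives. *)
Definition inH1 (f : R -> R) : Prop := [/\ ACloc f, inL2 f & inL2 (derive1 f)].

Definition inV (f : R -> R) : Prop :=
  [/\ continuous f, exists M, forall x, `|f x| <= M, ACloc f & inL2 (derive1 f)].

Definition normH1 (f : R -> R) : \bar R :=
  ('N[leb]_2[EFin \o f] + 'N[leb]_2[EFin \o derive1 f])%E.

Definition normV (f : R -> R) : \bar R :=
  (ereal_sup (range (fun x => `|f x|%:E)) + 'N[leb]_2[EFin \o derive1 f])%E.

(* X is a curve in the normed space of functions (E, norm), and X' is its
   derivative at time t in that space. *)
Definition derivative_in (E : set (R -> R)) (norm : (R -> R) -> \bar R)
    (X : R -> R -> R) (t : R) (X' : R -> R) : Prop :=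
  E X' /\
  norm (fun xi => h^-1 * (X (t + h) xi - X t xi) - X' xi) @[h --> 0^'] --> 0%E.

End Spaces.

Section CamassaHolm.
Context {R : realType}.
Notation leb := (@lebesgue_measure R).
Notation borel_measure := {finite_measure set (measurableTypeR R) -> \bar R}.

(* The second condition is the Lebesgue decomposition of mu: nu, which is
   carried by the null set Z, is its singular part. *)
Definition conservative_data (u : R -> R) (mu : borel_measure) : Prop :=
  inH1 u /\
  exists nu : borel_measure, exists Z : set R,
    [/\ measurable Z, leb Z = 0%E, nu (~` Z) = 0%E &
        forall B : set R, measurable B ->
          mu B = (nu B + \int[leb]_(x in B) (u x ^+ 2 + derive1 u x ^+ 2)%:E)%E].

Definition y_init (mu0 : borel_measure) (xi : R) : R :=
  sup [set x : R | (mu0 `]-oo, x[%classic + x%:E < xi%:E)%E].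

Definition lagP (y U H : R -> R) (xi : R) : R :=
  4^-1 * \int[leb]_eta (expR (- Num.sg (xi - eta) * (y xi - y eta)) *
                        (U eta ^+ 2 * derive1 y eta + derive1 H eta)).

Definition lagQ (y U H : R -> R) (xi : R) : R :=
  - (4^-1 * \int[leb]_eta (Num.sg (xi - eta) *
                           expR (- Num.sg (xi - eta) * (y xi - y eta)) *
                           (U eta ^+ 2 * derive1 y eta + derive1 H eta))).

Definition lagrangian_solution (y U H : R -> R -> R) : Prop :=
  let zeta t xi := y t xi - xi in
  forall t,
    [/\ inV (zeta t), inH1 (U t) & inV (H t)] /\
    [/\ derivative_in inV normV zeta t (U t),
        derivative_in inH1 normH1 U t (fun xi => - lagQ (y t) (U t) (H t) xi) &
        derivative_in inV normV H t
          (fun xi => U t xi ^+ 3 - 2 * lagP (y t) (U t) (H t) xi * U t xi)].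

Definition initial_data (u0 : R -> R) (mu0 : borel_measure)
    (y U H : R -> R -> R) : Prop :=
  forall xi, [/\ y 0 xi = y_init mu0 xi,
                 U 0 xi = u0 (y_init mu0 xi) &
                 H 0 xi = xi - y_init mu0 xi].

(* The graph of T_t: [flow t u0 mu0 u mu] means T_t (u0, mu0) = (u, mu).  The
   solution (y, U, H) is unique and y t is onto, so the initial data determine
   u and mu. *)
Definition flow (t : R) (u0 : R -> R) (mu0 : borel_measure)
    (u : R -> R) (mu : borel_measure) : Prop :=
  exists y U H : R -> R -> R,
    [/\ lagrangian_solution y U H,
        initial_data u0 mu0 y U H,
        forall xi, u (y t xi) = U t xi &
        forall B : set R, measurable B ->
          mu B = (\int[leb]_(xi in y t @^-1` B) (derive1 (H t) xi)%:E)%E].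

Definition global_conservative (u : R -> R -> R) (mu : R -> borel_measure) :
    Prop :=
  (forall t, conservative_data (u t) (mu t)) /\
  (forall s t, flow (t - s) (u s) (mu s) (u t) (mu t)).

Definition multi_peakon (u : R -> R -> R) (mu : R -> borel_measure) : Prop :=
  exists s, mu s `<< leb /\
    exists (M : nat) (p q : 'I_M -> R),
      forall x, u s x = \sum_(n < M) p n * expR (- `|x - q n|).

(* The integral of f against a signed measure, through its Jordan
   decomposition. *)
Definition charge_integral
    (nu : {charge set (measurableTypeR R) -> \bar R}) (f : R -> R) : R :=
  let: exist P nuP := cid (Hahn_decomposition nu) in
  let: exist N nuPN := cid nuP in
  \int[jordan_pos nuPN]_x f x - \int[jordan_neg nuPN]_x f x.

End CamassaHolm.

(* Main.v *)
Require Import Defs.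
From mathcomp Require Import measurable_realfun ring lra.
Import Order.TTheory GRing.Theory Num.Theory.
Import numFieldNormedType.Exports.

(* Write I1 = int u dx and I2 = mu(R): for a multi-peakon, u^2 + u_x^2 has the
   antiderivative -1/2 sum_n w_n sg(x - x_n) (e^{-|x - x_n|} u(x) - u(x_n)),
   so that its integral is int u d omega.  In Lagrangian variables the
   same quantities are the limits, as k tends to infinity, of
     int_{-k}^{k} U y_xi dxi   and   H(t, k) - H(t, -k),
   whose time derivatives are the boundary terms [U^2 / 2 - P]_{-k}^{k} (by
   P_xi = Q y_xi) and [U^3 - 2 P U]_{-k}^{k}.  Since U and P vanish at infinity,
   locally uniformly in time, both limits are conserved.  The Lagrangian flow is
   compared with (u, mu) at its two end times only. *)

Set Implicit Arguments.
Unset Strict Implicit.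
Unset Printing Implicit Defensive.

Local Open Scope ring_scope.
Local Open Scope classical_set_scope.

(** * Locally absolutely continuous functions *)

Section Primitive.
Context {R : realType}.
Notation leb := (@lebesgue_measure R).
Implicit Types f g h : R -> R.

Lemma aeS (P Q : set R) : P `<=` Q -> {ae leb, forall x, P x} ->
  {ae leb, forall x, Q x}.
Proof. by apply: filterS; exact: (ae_filter_ringOfSetsType leb). Qed.

Lemma locally_integrable_itv g a b : locally_integrable setT g ->
  leb.-integrable `[a, b] (EFin \o g).
Proof.
move=> [mg _ ig]; apply/integrableP; split.
  by apply/measurable_EFinP; exact: measurable_funTS.
exact: (ig _ _ (@segment_compact R a b)).
Qed.

Lemma locally_integrableI g : measurable_fun setT g ->
  (forall k : nat, leb.-integrable `[- k%:R, k%:R] (EFin \o g)) ->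
  locally_integrable setT g.
Proof.
move=> mg ig; split => // [|K _ cK]; first exact: openT.
have /compact_bounded[M [_ KM]] := cK.
have /integrableP[_] := ig (Num.truncn (`|M| + 1)).+1.
apply: le_lt_trans; apply: ge0_subset_integral => //.
- exact: compact_measurable.
- by apply/measurable_EFinP/measurableT_comp => //; exact: measurable_funTS.
- move=> x Kx /=; rewrite in_itv/= -ler_norml.
  apply: (KM (Num.truncn (`|M| + 1)).+1%:R) => //.
  apply: (@le_lt_trans _ _ `|M|); first exact: ler_norm.
  apply: lt_trans (truncnS_gt _); first by rewrite ltrDl.
Qed.

Lemma locally_integrableM f g : continuous f -> locally_integrable setT g ->
  locally_integrable setT (fun x => f x * g x).
Proof.
move=> cf lg.
have mf : measurable_fun setT f by exact: continuous_measurable_fun.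
have mg : measurable_fun setT g by case: lg.
apply: locally_integrableI; first exact: measurable_funM.
move=> k.
apply: (@integrableMr _ _ R leb _ _ f (EFin \o g)) => //.
- exact: measurable_funTS.
- have /compact_bounded := continuous_compact (continuous_subspaceT cf)
    (@segment_compact R (- k%:R) k%:R).
  by move=> [M [Mr kM]]; exists M; split => // x Mx y ky; apply: kM => //; exists y.
- exact: locally_integrable_itv.
Qed.

Lemma continuous_locally_integrable f : continuous f ->
  locally_integrable setT f.
Proof.
move=> cf; apply: locally_integrableI; first exact: continuous_measurable_fun.
move=> k; apply: continuous_compact_integrable; first exact: segment_compact.
exact: continuous_subspaceT.
Qed.

Lemma locally_integrableZ c g : locally_integrable setT g ->
  locally_integrable setT (fun x => c * g x).
Proof. by apply: locally_integrableM => x; exact: cvg_cst. Qed.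

Definition primitive f g : Prop :=
  locally_integrable setT g /\
  forall a b : R, a <= b -> f b - f a = \int[leb]_(x in `[a, b]) g x.

Lemma primitive_eq_deriv f g h : primitive f g ->
  measurable_fun setT h -> {ae leb, forall x, g x = h x} -> primitive f h.
Proof.
move=> [[mg oT ig] fg] mh gh.
have ghD (D : set R) : {ae leb, forall x, D x -> g x = h x}.
  by apply: aeS gh => x /= ->.
split.
  split => // K _ cK.
  apply: le_lt_trans (ig K _ cK) => //; rewrite le_eqVlt; apply/orP; left.
  apply/eqP; apply: ae_eq_integral.
  - exact: compact_measurable.
  - by apply/measurable_EFinP/measurableT_comp => //; exact: measurable_funTS.
  - by apply/measurable_EFinP/measurableT_comp => //; exact: measurable_funTS.
  - by apply: aeS (ghD K) => x /= /[apply] ->.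
move=> a b ab; rewrite fg// /Rintegral; congr fine.
apply: ae_eq_integral => //.
- by apply/measurable_EFinP; exact: measurable_funTS.
- by apply/measurable_EFinP; exact: measurable_funTS.
- by apply: aeS (ghD `[a, b]) => x /= /[apply] ->.
Qed.

Lemma primitiveD f1 g1 f2 g2 : primitive f1 g1 -> primitive f2 g2 ->
  primitive (fun x => f1 x + f2 x) (fun x => g1 x + g2 x).
Proof.
move=> [l1 e1] [l2 e2]; split; first exact: locally_integrableD.
move=> a b ab; rewrite RintegralD ?e1 ?e2//.
- by rewrite -e1// -e2//; ring.
- exact: locally_integrable_itv.
- exact: locally_integrable_itv.
Qed.

Lemma primitiveZ c f g : primitive f g ->
  primitive (fun x => c * f x) (fun x => c * g x).
Proof.
move=> [l e]; split; first exact: locally_integrableZ.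
move=> a b ab; rewrite RintegralZl//; last exact: locally_integrable_itv.
by rewrite -e// mulrBr.
Qed.

Lemma primitiveB f1 g1 f2 g2 : primitive f1 g1 -> primitive f2 g2 ->
  primitive (fun x => f1 x - f2 x) (fun x => g1 x - g2 x).
Proof.
move=> p1 /(primitiveZ (-1)) p2.
have := primitiveD p1 p2.
by under eq_fun do rewrite mulN1r; under [X in primitive _ X]eq_fun do rewrite mulN1r.
Qed.

Lemma primitive_cst c : primitive (cst c) (cst 0).
Proof.
split; first by apply: continuous_locally_integrable; exact: cst_continuous.
by move=> a b ab; rewrite subrr /Rintegral integral0.
Qed.

Lemma primitive_sum (I : Type) (s : seq I) (f g : I -> R -> R) :
  (forall i, primitive (f i) (g i)) ->
  primitive (fun x => \sum_(i <- s) f i x) (fun x => \sum_(i <- s) g i x).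
Proof.
move=> fg; elim: s => [|i s IHs].
  have := primitive_cst 0; congr primitive; apply/funext => x; by rewrite big_nil.
have := primitiveD (fg i) IHs.
by congr primitive; apply/funext => x; rewrite big_cons.
Qed.

Lemma primitive_id : primitive id (cst 1).
Proof.
split; first by apply: continuous_locally_integrable; exact: cst_continuous.
move=> a b ab; rewrite Rintegral_cst//= lebesgue_measure_itv/= lte_fin mul1r.
by case: ltgtP ab => //= -> _; rewrite subrr.
Qed.

Lemma primitive_continuous f g : primitive f g -> continuous f.
Proof.
move=> [lg fg] x.
have x1 : x - 1 <= x + 1 by lra.
have := parameterized_integral_continuous x1 (locally_integrable_itv (x - 1) (x + 1) lg).
rewrite continuous_within_itvP; last lra.
case=> + _ _ => /(_ x); rewrite in_itv/= => cx.
have {}cx : {for x, continuous (fun t => \int[leb]_(s in `[x - 1, t]) g s)}.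
  by apply: cx; lra.
have cf : (fun t => f (x - 1) + \int[leb]_(s in `[x - 1, t]) g s) t
    @[t --> x] --> f x.
  have -> : f x = f (x - 1) + \int[leb]_(s in `[x - 1, x]) g s.
    by rewrite -fg; [ring | lra].
  by apply: cvgD => //; exact: cvg_cst.
apply: cvg_trans cf; apply: near_eq_cvg.
near=> t; rewrite -fg; first by ring.
suff : t \in `]x - 1, x + 1[%R by rewrite in_itv/= => /andP[/ltW].
near: t; apply: near_in_itvoo; rewrite in_itv/=; lra.
Unshelve. all: by end_near. Qed.

Lemma primitive_is_derive f g x : primitive f g -> lebesgue_pt g x ->
  is_derive x 1 f (g x).
Proof.
move=> [lg fg] gx.
have x1 : x < x + 1 by lra.
have ax : (BLeft (x - 1)%R < BRight x)%E by rewrite (@lte_fin R); lra.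
have [dF F'] := FTC1_lebesgue_pt x1 (locally_integrable_itv (x - 1) (x + 1) lg) ax gx.
apply: (@near_eq_is_derive _ _ _
    (cst (f (x - 1)) + (fun t => \int[leb]_(s in `[x - 1, t]) g s))).
  near=> t; rewrite /= -[LHS]/(f (x - 1) + _) -fg; first by ring.
  suff : t \in `]x - 1, x + 1[%R by rewrite in_itv/= => /andP[/ltW].
  near: t; apply: near_in_itvoo; rewrite in_itv/=; lra.
have dF' : is_derive x 1 (fun t => \int[leb]_(s in `[x - 1, t]) g s) (g x).
  by rewrite -F' derive1E; exact: DeriveDef.
by rewrite -[g x]add0r; exact: (is_deriveD (is_derive_cst (f (x - 1)) x 1) dF').
Unshelve. all: by end_near. Qed.

Lemma primitive_ae_is_derive f g : primitive f g ->
  {ae leb, forall x, is_derive (x : R) 1 f (g x)}.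
Proof.
move=> fg; have [/lebesgue_differentiation + _] := fg.
by apply: aeS => x; exact: primitive_is_derive.
Qed.

Lemma primitive_derive1 f g : primitive f g ->
  {ae leb, forall x, derive1 f x = g x}.
Proof.
by move=> /primitive_ae_is_derive; apply: aeS => x /= fx; rewrite derive1E derive_val.
Qed.

Lemma primitive_is_derive_continuous f g (x : R) : primitive f g -> continuous g ->
  is_derive x 1 f (g x).
Proof.
move=> fg cg; apply: (primitive_is_derive fg).
apply: (@continuous_lebesgue_pt _ _ _ setT) => //; last exact: cg.
  by split => //; exact: openT.
exact: continuous_measurable_fun.
Qed.

End Primitive.

Section Chain.
Context {R : realType}.
Notation leb := (@lebesgue_measure R).
Implicit Types f g h : R -> R.

Lemma segment_additive_ind (P : R -> R -> Prop) (a b : R) : a <= b ->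
  (forall c d e : R, c <= d -> d <= e -> P c d -> P d e -> P c e) ->
  (forall x, a <= x <= b -> exists2 delta : R, 0 < delta &
     forall c d : R, x - delta < c -> c <= d -> d < x + delta -> P c d) ->
  P a b.
Proof.
move=> ab Padd Ploc.
have /compact_near_coveringP/(_ nat \oo (fun n x => forall d, x <= d ->
    d <= x + (b - a) / n.+1%:R -> P x d)) := @segment_compact R a b.
case=> [x|n _ /(_ n (leqnn n)) Pn].
  rewrite /= in_itv/= => /Ploc[delta delta0 Pdelta].
  have e0 : 0 < delta / 2 / (b - a + 1) by rewrite !divr_gt0//; lra.
  near=> x' n => /= d x'd dx'.
  have x'x : `|x - x'| < delta / 2.
    by near: x'; apply: cvgr_dist_lt; rewrite ?divr_gt0//; exact: cvg_id.
  have nd : (b - a) / n.+1%:R < delta / 2.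
    have : n.+1%:R^-1 < delta / 2 / (b - a + 1).
      by near: n; exact: (near_infty_natSinv_lt (PosNum e0)).
    have : 0 < n.+1%:R^-1 :> R by rewrite invr_gt0.
    move: (n.+1%:R^-1) => z z0; rewrite ltr_pdivlMr; last lra.
    by apply: le_lt_trans; rewrite mulrDr mulr1 mulrC lerDl ltW.
  move: x'x nd dx'; rewrite ltr_distl => /andP[? ?].
  move: ((b - a) / _) => z ? ?.
  by apply: Pdelta; lra.
set z := (b - a) / n.+1%:R in Pn.
have z0 : 0 <= z by rewrite divr_ge0// subr_ge0.
have zn : z * n.+1%:R = b - a by rewrite divfK// pnatr_eq0.
have step (i : nat) : (i <= n.+1)%N -> P a (a + z * i%:R).
  elim: i => [_|i IHi iN].
    by apply: Pn; rewrite ?mulr0 ?addr0 ?lerDl//= in_itv/= lexx.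
  have zi : 0 <= z * i%:R by rewrite mulr_ge0.
  have zib : z * i%:R <= b - a by rewrite -[leRHS]zn ler_wpM2l// ler_nat ltnW.
  apply: (Padd _ (a + z * i%:R)) (IHi (ltnW iN)) _.
  - by rewrite lerDl.
  - by rewrite lerD2l ler_wpM2l// ler_nat.
  - apply: Pn; rewrite /= ?in_itv/=.
    + by apply/andP; split; lra.
    + by rewrite lerD2l ler_wpM2l// ler_nat.
    + by rewrite -addrA lerD2l -natr1 mulrDr mulr1.
by have := step n.+1 (leqnn _); rewrite zn addrC subrK.
Unshelve. all: by end_near. Qed.

Lemma Rintegral_itv_split g a c b : locally_integrable setT g ->
  a <= c -> c <= b ->
  \int[leb]_(x in `[a, b]) g x =
  \int[leb]_(x in `[a, c]) g x + \int[leb]_(x in `[c, b]) g x.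
Proof.
move=> lg ac cb.
have := @Rintegral_itvB R g (BLeft a) (BRight b) c (locally_integrable_itv a b lg).
rewrite !bnd_simp => /(_ ac cb).
rewrite Rintegral_itv_obnd_cbnd => [<-|]; first by rewrite addrC subrK.
apply: integrableS (locally_integrable_itv c b lg) => //.
by move=> x /=; rewrite !in_itv/= => /andP[/ltW -> ->].
Qed.

Lemma mean_value (G G' : R -> R) (p q : R) :
  (forall x : R, is_derive x 1 G (G' x)) ->
  exists2 z, Num.min p q <= z <= Num.max p q & G q - G p = G' z * (q - p).
Proof.
move=> dG.
have cG : continuous G.
  by move=> x; apply: differentiable_continuous; apply/derivable1_diffP.
wlog pq : p q / p <= q => [H|].
  have /orP[/H//|/H[z zqp e]] := le_total p q.
  exists z; first by rewrite minC maxC.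
  by rewrite -opprB e; ring.
have [|z zpq ->] := @MVT_segment R G G' p q pq (fun x _ => dG x).
  exact: continuous_subspaceT.
by exists z => //; rewrite (min_idPl pq) (max_idPr pq); move: zpq; rewrite in_itv.
Qed.

Lemma locally_integrable_norm g : locally_integrable setT g ->
  locally_integrable setT (fun x => `|g x|).
Proof.
move=> [mg oT ig]; split => //; first exact: measurableT_comp.
by move=> K KT cK; under eq_integral do rewrite normr_id; exact: ig.
Qed.

Lemma primitive_comp (G G' : R -> R) f g :
  (forall x : R, is_derive x 1 G (G' x)) -> continuous G' -> primitive f g ->
  primitive (fun x => G (f x)) (fun x => G' (f x) * g x).
Proof.
move=> dG cG' fg.
have cf := primitive_continuous fg.
have [lg fgE] := fg.
have lGg : locally_integrable setT (fun x => G' (f x) * g x).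
  by apply: locally_integrableM => // x; apply: continuous_comp; [exact: cf|exact: cG'].
have lng := locally_integrable_norm lg.
split=> // a b ab; apply/eqP; rewrite -subr_eq0 -normr_le0.
suff eps_bound e : 0 < e ->
    `|G (f b) - G (f a) - \int[leb]_(x in `[a, b]) (G' (f x) * g x)| <=
    e * \int[leb]_(x in `[a, b]) `|g x|.
  set I := \int[leb]_(x in `[a, b]) `|g x| in eps_bound.
  have I0 : 0 <= I by exact: Rintegral_ge0.
  apply/ler_addgt0Pl => e e0; rewrite addr0.
  apply: le_trans (eps_bound (e / (I + 1)) _) _; first by rewrite divr_gt0//; lra.
  by rewrite mulrAC ler_pdivrMr; nra.
move=> e0.
apply: (@segment_additive_ind (fun c d =>
  `|G (f d) - G (f c) - \int[leb]_(x in `[c, d]) (G' (f x) * g x)| <=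
    e * \int[leb]_(x in `[c, d]) `|g x|)) => // [c d k cd dk cdP dkP|x _].
  rewrite (Rintegral_itv_split lGg cd dk) (Rintegral_itv_split lng cd dk) mulrDr.
  apply: le_trans (lerD cdP dkP); apply: le_trans (ler_normD _ _).
  by rewrite le_eqVlt; apply/orP; left; apply/eqP; congr `| _ |; ring.
have e2 : 0 < e / 2 by lra.
have /cvgrPdist_lt/(_ _ e2)[eta /= eta0 Geta] := cG' (f x).
have /cvgrPdist_lt/(_ _ eta0)[delta /= delta0 fdelta] := cf x.
exists delta => // c d xc cd dx.
have fx t : c <= t <= d -> `|f x - f t| < eta.
  by move=> tcd; apply: fdelta => /=; rewrite ltr_distl; lra.
have [z /andP[z1 z2] ->] := mean_value (f c) (f d) dG.
have xz : `|f x - z| < eta.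
  have := fx d; rewrite cd lexx ltr_distl => /(_ isT) /andP[? ?].
  have := fx c; rewrite cd lexx ltr_distl => /(_ isT) /andP[? ?].
  rewrite ltr_distl; apply/andP; split.
    by move: z2; rewrite le_max => /orP[?|?]; lra.
  by move: z1; rewrite ge_min => /orP[?|?]; lra.
have Gz := Geta _ xz.
rewrite fgE// -RintegralZl//; last exact: locally_integrable_itv.
rewrite -RintegralB//; last 2 first.
- by apply: locally_integrable_itv; exact: locally_integrableZ.
- exact: locally_integrable_itv.
rewrite -RintegralZl//; last exact: locally_integrable_itv.
have lD : locally_integrable setT (fun t => G' z * g t - G' (f t) * g t).
  by apply: locally_integrableB => //; exact: locally_integrableZ.
apply: le_trans (le_normr_Rintegral _ (locally_integrable_itv _ _ lD)) _ => //.
apply: le_Rintegral => //.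
- by apply: locally_integrable_itv; exact: locally_integrable_norm.
- by apply: locally_integrable_itv; exact: locally_integrableZ.
- move=> t /=; rewrite in_itv/= => tcd; rewrite -mulrBl normrM ler_wpM2r//.
  have := Geta _ (fx _ tcd); have := Gz; rewrite !ltr_norml ler_norml.
  move=> /andP[? ?] /andP[? ?]; lra.
Qed.

Lemma primitive_sqr f g : primitive f g ->
  primitive (fun x => f x ^+ 2) (fun x => 2 * f x * g x).
Proof.
apply: (@primitive_comp (fun x => x ^+ 2) (fun x => 2 * x)).
  by move=> x; apply: is_derive_eq; rewrite /GRing.scale/=; ring.
by move=> x; apply: cvgM; [exact: cvg_cst|exact: cvg_id].
Qed.

Lemma primitiveM f1 g1 f2 g2 : primitive f1 g1 -> primitive f2 g2 ->
  primitive (fun x => f1 x * f2 x) (fun x => g1 x * f2 x + f1 x * g2 x).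
Proof.
move=> p1 p2.
have /primitive_sqr := primitiveD p1 p2.
have /primitive_sqr := primitiveB p1 p2.
move=> /[swap] /primitiveB /[apply] /(primitiveZ (1 / 4)).
by congr primitive; apply/funext => x /=; field.
Qed.

Lemma measurable_sg (a : R) : measurable_fun setT (fun x : R => Num.sg (x - a)).
Proof.
have -> : (fun x : R => Num.sg (x - a)) =
    (fun x => if x == a then 0 else if x < a then -1 else 1).
  by apply/funext => x; rewrite /Num.sg subr_eq0 subr_lt0.
apply: measurable_fun_ifT => //; first exact: measurable_fun_eqr.
by apply: measurable_fun_ifT => //; exact: measurable_fun_ltr.
Qed.

(* The jump of the sign at [a] is compensated by the zero of [f - f a]. *)
Lemma primitive_sg a f g : primitive f g ->
  primitive (fun x => Num.sg (x - a) * (f x - f a))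
            (fun x => Num.sg (x - a) * g x).
Proof.
move=> fg; have [lg fgE] := fg.
have lsg : locally_integrable setT (fun x => Num.sg (x - a) * g x).
  have mg : measurable_fun setT g by case: lg.
  apply: locally_integrableI.
    by apply: measurable_funM => //; exact: measurable_sg.
  move=> k; apply: (@integrableMr _ _ R leb _ _ (fun x => Num.sg (x - a)) (EFin \o g)) => //.
  - by apply: measurable_funTS; exact: measurable_sg.
  - exists 1; split => // M M1 x _ /=; rewrite normr_sg.
    by apply: le_trans (ltW M1); case: (_ != _); rewrite /= ?ler01 ?lexx.
  - exact: locally_integrable_itv.
split => //.
have right c d : a <= c -> c <= d ->
    Num.sg (d - a) * (f d - f a) - Num.sg (c - a) * (f c - f a) =
    \int[leb]_(x in `[c, d]) (Num.sg (x - a) * g x).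
  move=> ac cd.
  have sgE t : a <= t -> Num.sg (t - a) * (f t - f a) = f t - f a.
    by rewrite le_eqVlt => /predU1P[->|at_]; [ring|rewrite gtr0_sg ?subr_gt0 ?mul1r].
  rewrite !sgE ?(le_trans ac)//; transitivity (f d - f c); first by ring.
  rewrite -Rintegral_itv_obnd_cbnd; last first.
    apply: integrableS (locally_integrable_itv c d lsg) => //.
    by move=> x /=; rewrite !in_itv/= => /andP[/ltW -> ->].
  rewrite fgE// -Rintegral_itv_obnd_cbnd; last first.
    apply: integrableS (locally_integrable_itv c d lg) => //.
    by move=> x /=; rewrite !in_itv/= => /andP[/ltW -> ->].
  apply: eq_Rintegral => x; rewrite inE/= in_itv/= => /andP[cx _].
  by rewrite gtr0_sg ?mul1r// subr_gt0 (le_lt_trans ac).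
have left c d : c <= d -> d <= a ->
    Num.sg (d - a) * (f d - f a) - Num.sg (c - a) * (f c - f a) =
    \int[leb]_(x in `[c, d]) (Num.sg (x - a) * g x).
  move=> cd da.
  have sgE t : t <= a -> Num.sg (t - a) * (f t - f a) = - (f t - f a).
    by rewrite le_eqVlt => /predU1P[->|ta]; [ring|rewrite ltr0_sg ?subr_lt0 ?mulN1r].
  rewrite !sgE ?(le_trans cd)//.
  transitivity (-1 * (f d - f c)); first by ring.
  rewrite fgE// -RintegralZl//; last exact: locally_integrable_itv.
  rewrite -[RHS]Rintegral_itv_bndo_bndc; last first.
    apply: integrableS (locally_integrable_itv c d lsg) => //.
    by move=> x /=; rewrite !in_itv/= => /andP[-> /ltW ->].
  rewrite -Rintegral_itv_bndo_bndc; last first.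
    apply: integrableS (locally_integrable_itv c d (locally_integrableZ (-1) lg)) => //.
    by move=> x /=; rewrite !in_itv/= => /andP[-> /ltW ->].
  apply: eq_Rintegral => x; rewrite inE/= in_itv/= => /andP[_ xd].
  by rewrite ltr0_sg// subr_lt0 (lt_le_trans xd).
move=> c d cd.
have [ac|/ltW ca] := leP a c; first exact: right.
have [da|/ltW ad] := leP d a; first exact: left.
by rewrite (Rintegral_itv_split lsg ca ad) -left// -right//; ring.
Qed.

End Chain.

(** * Square-integrable functions *)

Section L2.
Context {R : realType}.
Notation leb := (@lebesgue_measure R).
Local Notation itvN k := [set` (`[(- k%:R)%R, k%:R%R]%R : interval R)].
Implicit Types f g h : R -> R.

Definition n2 f : R := fine ('N[leb]_2%:E[EFin \o f])%E.

Lemma n2_ge0 f : 0 <= n2 f.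
Proof. by rewrite fine_ge0// Lnorm_ge0. Qed.

Lemma inL2_measurable f : inL2 f -> measurable_fun setT f.
Proof. by rewrite /inL2 inE => /andP[]; rewrite inE. Qed.

Lemma inL2_sqr f : inL2 f -> leb.-integrable setT (EFin \o (fun x => f x ^+ 2)).
Proof. exact: Lfun2_integrable_sqr. Qed.

Lemma n2E f : inL2 f -> ('N[leb]_2%:E[EFin \o f])%E = (n2 f)%:E.
Proof.
rewrite /inL2 inE => /andP[_]; rewrite inE/= => ff.
by rewrite /n2 fineK// ge0_fin_numE// Lnorm_ge0.
Qed.

Lemma Lnorm2_sqr f :
  (('N[leb]_2%:E[EFin \o f] `^ 2) = \int[leb]_x (f x ^+ 2)%:E)%E.
Proof.
rewrite poweR_Lnorm//; apply: eq_integral => x _ /=.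
by rewrite powR_mulrn// -normrX ger0_norm ?sqr_ge0.
Qed.

Lemma inL2I f : measurable_fun setT f ->
  leb.-integrable setT (EFin \o (fun x => f x ^+ 2)) -> inL2 f.
Proof.
move=> mf /integrableP[_ i2]; rewrite /inL2 inE; apply/andP; rewrite !inE/=; split => //.
apply: (@lty_poweRy _ _ 2) => //; rewrite Lnorm2_sqr.
by apply: le_lt_trans i2; rewrite le_eqVlt; apply/orP; left; apply/eqP;
  apply: eq_integral => x _ /=; rewrite ger0_norm ?sqr_ge0.
Qed.

Lemma n2_sqr f : inL2 f -> n2 f ^+ 2 = \int[leb]_x (f x ^+ 2).
Proof.
move=> f2; apply: EFin_inj; rewrite -powR_mulrn ?n2_ge0//.
rewrite -poweR_EFin -n2E// Lnorm2_sqr /Rintegral fineK//.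
exact: (integrable_fin_num _ (inL2_sqr f2)).
Qed.

Lemma inL2D f g : inL2 f -> inL2 g -> inL2 (fun x => f x + g x).
Proof.
have p1 : (1 <= 2%:E :> \bar R)%E by rewrite lee_fin ler1n.
by case: (Lfun_addr_closed leb p1) => _ H f2 g2; exact: (H f g f2 g2).
Qed.

Lemma inL2Z c f : inL2 f -> inL2 (fun x => c * f x).
Proof.
have p1 : (1 <= 2 :> R) by rewrite ler1n.
have -> : (fun x => c * f x) = (fun x => f x * c) by apply/funext => x; rewrite mulrC.
exact: (Lfun_scale c p1).
Qed.

Lemma inL2N f : inL2 f -> inL2 (fun x => - f x).
Proof. by move=> /(inL2Z (-1)); under eq_fun do rewrite mulN1r. Qed.

Lemma inL2B f g : inL2 f -> inL2 g -> inL2 (fun x => f x - g x).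
Proof. by move=> f2 /inL2N; exact: inL2D. Qed.

Lemma inL2_le f g : measurable_fun setT f -> (forall x, `|f x| <= `|g x|) ->
  inL2 g -> inL2 f.
Proof.
move=> mf fg g2; apply: inL2I => //.
apply: le_integrable (inL2_sqr g2) => //.
  by apply/measurable_EFinP; exact: measurable_funX.
by move=> x _ /=; rewrite lee_fin !normrX lerXn2r ?nnegrE.
Qed.

Lemma n2_le f g : measurable_fun setT f -> (forall x, `|f x| <= `|g x|) ->
  inL2 g -> n2 f <= n2 g.
Proof.
move=> mf fg g2; have f2 := inL2_le mf fg g2.
rewrite -(@ler_pXn2r _ 2) ?nnegrE ?n2_ge0// !n2_sqr//.
apply: le_Rintegral => //; [exact: inL2_sqr|exact: inL2_sqr|].
by move=> x _; rewrite -[leLHS]real_normK ?num_real// -[leRHS]real_normK ?num_real// lerXn2r ?nnegrE.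
Qed.

Lemma n2Z c f : inL2 f -> n2 (fun x => c * f x) = `|c| * n2 f.
Proof.
move=> f2; apply/eqP.
rewrite -(@eqrXn2 _ 2) ?mulr_ge0 ?n2_ge0// exprMn !n2_sqr//; last exact: inL2Z.
under eq_Rintegral do rewrite exprMn.
by rewrite RintegralZl ?real_normK ?num_real//; exact: inL2_sqr.
Qed.

Lemma n2D f g : inL2 f -> inL2 g -> n2 (fun x => f x + g x) <= n2 f + n2 g.
Proof.
move=> f2 g2; rewrite -lee_fin EFinD -!n2E//; last exact: inL2D.
by apply: eminkowski; rewrite ?lee_fin ?ler1n//; exact: inL2_measurable.
Qed.

Lemma n2_trans f g : inL2 f -> inL2 g -> n2 f <= n2 g + n2 (fun x => f x - g x).
Proof.
move=> f2 g2; apply: le_trans (n2D g2 (inL2B f2 g2)).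
by rewrite le_eqVlt; apply/orP; left; apply/eqP; congr n2; apply/funext => x; ring.
Qed.

Lemma inL2M_integrable f g (D : set R) : measurable D -> inL2 f -> inL2 g ->
  leb.-integrable D (EFin \o (fun x => f x * g x)).
Proof.
move=> mD f2 g2; have /Lfun1_integrable := Lfun2_mul_Lfun1 f2 g2.
by apply: integrableS.
Qed.

Lemma Rintegral_abs_le f g (D : set R) : measurable D -> inL2 f -> inL2 g ->
  \int[leb]_(x in D) `|f x * g x| <= n2 f * n2 g.
Proof.
move=> mD f2 g2.
have ifg := inL2M_integrable measurableT f2 g2.
apply: (@le_trans _ _ (\int[leb]_x `|f x * g x|)).
  rewrite fine_le//.
  - by apply: integrable_fin_num => //; apply/integrable_norm/inL2M_integrable.
  - by apply: integrable_fin_num => //; apply/integrable_norm.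
  - apply: ge0_subset_integral => //; apply/measurable_EFinP.
    by apply: measurableT_comp => //; apply: measurable_funM; exact: inL2_measurable.
have := @hoelder _ _ _ leb f g 2 2 (inL2_measurable f2) (inL2_measurable g2).
rewrite !n2E// Lnorm1 -EFinM => /(_ (ltr0n _ _) (ltr0n _ _)) H.
rewrite -lee_fin /Rintegral fineK; first by apply: H; rewrite [RHS]splitr !div1r.
by apply: integrable_fin_num => //; apply/integrable_norm.
Qed.

Lemma normr_Rintegral_le f g (D : set R) : measurable D -> inL2 f -> inL2 g ->
  `|\int[leb]_(x in D) (f x * g x)| <= n2 f * n2 g.
Proof.
move=> mD f2 g2; apply: le_trans (Rintegral_abs_le mD f2 g2).
by apply: le_normr_Rintegral => //; exact: inL2M_integrable.
Qed.

Lemma inL2_indic_itv (a b : R) : inL2 (\1_`[a, b] : R -> R).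
Proof.
apply: inL2I; first exact: measurable_indic.
have := @integrable_indic_itv R a b true false.
congr (leb.-integrable _ _); apply/funext => x /=.
by rewrite indicE; case: (_ \in _); rewrite ?expr1n ?expr0n.
Qed.

Lemma bigcup_itvNn : \bigcup_k itvN k = [set: R].
Proof.
rewrite -subTset => x _; exists (Num.truncn `|x|).+1 => //=.
by rewrite in_itv/= -ler_norml ltW// truncnS_gt.
Qed.

Lemma le_itvNn : {homo (fun k : nat => itvN k) :
  n m / (n <= m)%N >-> (n <= m)%O}.
Proof.
move=> n m nm; apply/subsetPset => x /=; rewrite !in_itv/= -!ler_norml.
by move=> /le_trans; apply; rewrite ler_nat.
Qed.

Lemma ge0_cvg_itvNn g : measurable_fun setT g -> (forall x, 0 <= g x) ->
  (\int[leb]_(x in itvN k) (g x)%:E @[k --> \oo] -->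
   \int[leb]_x (g x)%:E)%E.
Proof.
move=> mg g0; rewrite -bigcup_itvNn.
apply: ge0_nondecreasing_set_cvg_integral => [|//|k|k x _].
- exact: le_itvNn.
- by apply/measurable_EFinP; exact: measurable_funTS.
- by rewrite lee_fin.
Qed.

Lemma primitive_ge0_integrable M f g : primitive f g -> (forall x, 0 <= g x) ->
  (forall x, `|f x| <= M) ->
  leb.-integrable setT (EFin \o g) /\ \int[leb]_x g x <= 2 * M.
Proof.
move=> [lg fg] g0 fM.
have mg : measurable_fun setT g by case: lg.
have intM : (\int[leb]_x (g x)%:E <= (2 * M)%:E)%E.
  have cg := ge0_cvg_itvNn mg g0.
  rewrite -(cvg_lim _ cg)//; apply: lime_le; first by apply/cvg_ex; eexists; exact: cg.
  apply: nearW => k.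
  have -> : (\int[leb]_(x in itvN k) (g x)%:E =
      (\int[leb]_(x in itvN k) g x)%:E)%E.
    rewrite /Rintegral fineK//.
    by apply: integrable_fin_num => //; exact: locally_integrable_itv.
  rewrite -fg ?ge0_cp// lee_fin; apply: le_trans (ler_norm _) _.
  by apply: le_trans (ler_normB _ _) _; rewrite mulr2n mulrDl mul1r lerD.
split.
  apply/integrableP; split; first exact/measurable_EFinP.
  under eq_integral do rewrite /= ger0_norm//.
  exact: le_lt_trans intM (ltry _).
rewrite -lee_fin /Rintegral fineK// ge0_fin_numE ?(le_lt_trans intM (ltry _))//.
by apply: integral_ge0 => x _; rewrite lee_fin.
Qed.

Lemma primitive_cvg f g : leb.-integrable setT (EFin \o g) -> primitive f g ->
  f k%:R - f (- k%:R) @[k --> \oo] --> \int[leb]_x g x.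
Proof.
move=> ig [lg fg].
have mg : measurable_fun setT g by case: lg.
have -> : (fun k : nat => f k%:R - f (- k%:R)) =
    (fun k : nat => \int[leb]_(x in itvN k) g x).
  by apply/funext => k; rewrite -fg// ge0_cp.
have dom : (\int[leb]_x ((EFin \o g) \_ (itvN k)) x @[k --> \oo] -->
    \int[leb]_x (EFin \o g) x)%E.
  apply: (@dominated_cvg _ _ _ leb setT measurableT _ (EFin \o g)
    (fun x => `|g x|%:E)) => //.
  - move=> k; apply/(measurable_restrictT _ _).1 => //.
    by apply/measurable_EFinP; exact: measurable_funTS.
  - move=> x _; apply: cvg_near_cst; near=> k.
    rewrite patchE mem_set//= in_itv/= -ler_norml.
    by near: k; exact: nbhs_infty_ger.
  - exact: (integrable_norm ig).
  - by move=> k x _; rewrite patchE; case: ifPn => // _; rewrite abse0 lee_fin.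
apply: fine_cvg; rewrite fineK; last exact: integrable_fin_num.
by under eq_fun do rewrite integral_mkcond.
Unshelve. all: by end_near. Qed.

End L2.

Section Weight.
Context {R : realType}.
Notation leb := (@lebesgue_measure R).
Implicit Types f g h : R -> R.

Lemma ae_neq (a : R) : {ae leb, forall x, x <> a}.
Proof.
exists [set a]; split => //; first exact: lebesgue_measure_set1.
by move=> x /= /contrapT.
Qed.

Lemma measurable_fun_expR_dist (a c : R) :
  measurable_fun setT (fun x : R => expR (c * `|a - x|)).
Proof.
apply: measurableT_comp => //; apply: measurable_funM => //.
by apply: measurableT_comp => //; exact: measurable_funB.
Qed.

Lemma primitive_normB (a : R) :
  primitive (fun x => `|x - a|) (fun x => Num.sg (x - a)).
Proof.
have := primitive_sg a (@primitive_id R); congr primitive; apply/funext => x /=.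
- by rewrite -normrEsg.
- by rewrite mulr1.
Qed.

Lemma primitive_expR f g : primitive f g ->
  primitive (fun x => expR (f x)) (fun x => expR (f x) * g x).
Proof.
exact: (primitive_comp (@is_derive_expR R) (@continuous_expR R)).
Qed.

Lemma primitive_peakon (a : R) :
  primitive (fun x => expR (- `|x - a|))
            (fun x => - Num.sg (x - a) * expR (- `|x - a|)).
Proof.
have := primitive_expR (primitiveZ (-1) (primitive_normB a)).
by congr primitive; apply/funext => x; rewrite !mulN1r// mulrC.
Qed.

Lemma primitive_int_peakon (a : R) :
  primitive (fun x => Num.sg (x - a) * (1 - expR (- `|x - a|)))
            (fun x => expR (- `|x - a|)).
Proof.
have := primitiveZ (-1) (primitive_sg a (primitive_peakon a)).
rewrite subrr normr0 oppr0 expR0 => p.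
have {}p : primitive (fun x => Num.sg (x - a) * (1 - expR (- `|x - a|)))
    (fun x => -1 * (Num.sg (x - a) * (- Num.sg (x - a) * expR (- `|x - a|)))).
  by move: p; congr primitive; apply/funext => x /=; ring.
apply: (primitive_eq_deriv p).
  apply: continuous_measurable_fun; exact: (primitive_continuous (primitive_peakon a)).
apply: aeS (@ae_neq a) => x /= /eqP xa.
have : Num.sg (x - a) ^+ 2 = 1 by rewrite sqr_sg subr_eq0 xa.
set s := Num.sg _ => s1; transitivity (s ^+ 2 * expR (- `|x - a|)); first by ring.
by rewrite s1 mul1r.
Qed.

Definition wgt (b eta : R) : R := expR (- `|b - eta| / 2).

Lemma wgt_gt0 b eta : 0 < wgt b eta. Proof. exact: expR_gt0. Qed.

Lemma wgt_le1 b eta : wgt b eta <= 1.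
Proof. by rewrite -expR0 ler_expR mulNr oppr_le0 divr_ge0. Qed.

Lemma measurable_wgt b : measurable_fun setT (wgt b).
Proof.
have := measurable_fun_expR_dist b (- 2^-1).
by congr measurable_fun; apply/funext => x; rewrite /wgt mulNr mulrC mulNr.
Qed.

Lemma wgt_sqr b eta : wgt b eta ^+ 2 = expR (- `|b - eta|).
Proof. by rewrite /wgt -expRM_natl; congr expR; field. Qed.

Lemma inL2_wgt b : inL2 (wgt b) /\ n2 (wgt b) <= 2.
Proof.
have [] := @primitive_ge0_integrable R 1 _ _ (primitive_int_peakon b).
- by move=> x; exact: expR_ge0.
- move=> x; rewrite normrM normr_sg.
  have e0 := expR_gt0 (- `|x - b|).
  have e1 : expR (- `|x - b|) <= 1 by rewrite -expR0 ler_expR oppr_le0.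
  by rewrite (ger0_norm (_ : 0 <= 1 - _)) ?subr_ge0//; case: (_ != _) => /=; lra.
move=> i1 i2.
have e : (fun x => wgt b x ^+ 2) = (fun x => expR (- `|x - b|)).
  by apply/funext => x; rewrite wgt_sqr distrC.
have w2 : inL2 (wgt b) by apply: inL2I; [exact: measurable_wgt|rewrite e].
split=> //; rewrite -(@ler_pXn2r _ 2) ?nnegrE ?n2_ge0// n2_sqr// e.
by apply: le_trans i2 _; rewrite mulr1 expr2; lra.
Qed.

(* [wn b f ^+ 2] is the integral of [e^{-|b - eta|} f(eta)^2]. *)
Definition wn (b : R) f : R := n2 (fun eta => wgt b eta * f eta).

Lemma wgt_norm_le b f eta : `|wgt b eta * f eta| <= `|f eta|.
Proof.
by rewrite normrM ger0_norm ?(ltW (wgt_gt0 _ _))// ler_piMl// wgt_le1.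
Qed.

Lemma inL2_wgtM b f : inL2 f -> inL2 (fun eta => wgt b eta * f eta).
Proof.
move=> f2; apply: (inL2_le _ _ f2); last by move=> eta; exact: wgt_norm_le.
apply: measurable_funM; [exact: measurable_wgt|exact: inL2_measurable].
Qed.

Lemma wn_ge0 b f : 0 <= wn b f. Proof. exact: n2_ge0. Qed.

Lemma wn_le b f : inL2 f -> wn b f <= n2 f.
Proof.
move=> f2; apply: (n2_le _ _ f2); last by move=> eta; exact: wgt_norm_le.
by apply: measurable_funM; [exact: measurable_wgt|exact: inL2_measurable].
Qed.

Lemma wn_trans b f g : inL2 f -> inL2 g ->
  wn b f <= wn b g + n2 (fun eta => f eta - g eta).
Proof.
move=> f2 g2; apply: le_trans (n2_trans (inL2_wgtM b f2) (inL2_wgtM b g2)) _.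
rewrite lerD2l; apply: le_trans (wn_le b (inL2B f2 g2)).
by rewrite /wn; under [in leRHS]eq_fun do rewrite mulrBr.
Qed.

Lemma wn_cvg (b : nat -> R) f : (forall k, `|b k| = k%:R) -> inL2 f ->
  wn (b k) f @[k --> \oo] --> 0.
Proof.
move=> bk f2.
have sq0 : wn (b k) f ^+ 2 @[k --> \oo] --> 0.
  have -> : (fun k => wn (b k) f ^+ 2) =
      (fun k => \int[leb]_x (expR (- `|b k - x|) * f x ^+ 2)).
    apply/funext => k; rewrite /wn n2_sqr; last exact: inL2_wgtM.
    by apply: eq_Rintegral => x _; rewrite exprMn wgt_sqr.
  have -> : 0 = fine (\int[leb]_x (cst 0%E x)) :> R by rewrite integral0.
  apply: fine_cvg; rewrite fineK; last by rewrite integral0.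
  apply: (@dominated_cvg _ _ _ leb setT measurableT _ _ (fun x => (f x ^+ 2)%:E)) => //.
  - move=> k; apply/measurable_EFinP; apply: measurable_funM.
      have := measurable_fun_expR_dist (b k) (-1).
      by congr measurable_fun; apply/funext => x; rewrite mulN1r.
    by apply: measurable_funX; exact: inL2_measurable.
  - move=> x _; apply: cvg_EFin; first exact: nearW.
    rewrite /comp/= -[X in _ --> X](mul0r (f x ^+ 2)); apply: cvgM; last exact: cvg_cst.
    apply: (@squeeze_cvgr _ _ _ _ (cst 0) (fun k : nat => expR `|x| * expR (- k%:R))).
    + apply: nearW => k; rewrite expR_ge0/= -expRD ler_expR -(bk k).
      by have := lerB_dist (b k) x; lra.
    + exact: cvg_cst.
    + by rewrite -[X in _ --> X](mulr0 (expR `|x|)); apply: cvgM; [exact: cvg_cst|exact: cvgn_expR].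
  - exact: inL2_sqr.
  - move=> k x _; rewrite /= lee_fin normrM ger0_norm ?expR_ge0// ger0_norm ?sqr_ge0//.
    by rewrite ler_piMl ?sqr_ge0// -expR0 ler_expR oppr_le0.
apply/cvgrPdist_lt => e e0.
have e20 : 0 < e ^+ 2 by rewrite exprn_gt0.
move/cvgrPdist_lt : sq0 => /(_ _ e20); apply: filterS => k.
by rewrite !sub0r !normrN normrX ltr_pXn2r// nnegrE ?normr_ge0// ltW.
Qed.

Lemma primitive_sqr_le_wn b f g : primitive f g -> inL2 f -> inL2 g ->
  f b ^+ 2 <= 2 * expR 1 * (wn b f ^+ 2 + wn b g ^+ 2).
Proof.
move=> fg f2 g2.
have h : primitive (fun x => b + 1 - x) (cst (-1)).
  have := primitiveB (primitive_cst (b + 1)) (@primitive_id R).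
  by congr primitive; apply/funext => x /=; rewrite sub0r.
have [_ /(_ b (b + 1))] := primitiveM h (primitive_sqr fg).
rewrite subrr mul0r add0r lerDl ler01 addrAC subrr add0r mul1r => /(_ isT) e.
have lL : locally_integrable setT (fun x => -1 * f x ^+ 2 + (b + 1 - x) * (2 * f x * g x)).
  by have [] := primitiveM h (primitive_sqr fg).
pose F x : R := (wgt b x * f x) ^+ 2 + (wgt b x * g x) ^+ 2.
have i1 := inL2_sqr (inL2_wgtM b f2).
have i2 := inL2_sqr (inL2_wgtM b g2).
have iF : leb.-integrable setT (EFin \o F) by exact: (integrableD measurableT i1 i2).
have -> : f b ^+ 2 = \int[leb]_(x in `[b, b + 1])
    (-1 * (-1 * f x ^+ 2 + (b + 1 - x) * (2 * f x * g x))).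
  by rewrite RintegralZl ?mulN1r -?e ?opprK//; exact: locally_integrable_itv.
rewrite /wn !n2_sqr; [|exact: inL2_wgtM|exact: inL2_wgtM].
rewrite -RintegralD// -RintegralZl//.
have iF' : leb.-integrable setT (EFin \o (fun x => 2 * expR 1 * F x)).
  exact: (integrableZl measurableT (2 * expR 1) iF).
apply: (@le_trans _ _ (\int[leb]_(x in `[b, b + 1]) (2 * expR 1 * F x))).
  apply: le_Rintegral => //.
  - by apply: locally_integrable_itv; exact: locally_integrableZ.
  - exact: integrableS iF'.
  - move=> x /=; rewrite in_itv/= => /andP[bx xb].
    have x1 : -1 <= - `|b - x| by rewrite lerN2 ler_norml; apply/andP; split; lra.
    have e1 : 1 <= expR 1 * expR (- `|b - x|).
      by rewrite -expRD -[leLHS]expR0 ler_expR; lra.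
    have -> : 2 * expR 1 * F x =
        2 * (expR 1 * expR (- `|b - x|) * (f x ^+ 2 + g x ^+ 2)).
      by rewrite /F !exprMn wgt_sqr; ring.
    apply: (@le_trans _ _ (2 * (f x ^+ 2 + g x ^+ 2))).
      have s0 : 0 <= b + 1 - x <= 1 by apply/andP; split; lra.
      move: (b + 1 - x) s0 => s /andP[s0 s1].
      have := sqr_ge0 (f x); have := sqr_ge0 (g x).
      have : 0 <= s * (f x + g x) ^+ 2 by rewrite mulr_ge0// sqr_ge0.
      by nra.
    by rewrite ler_pM2l// ler_peMl// addr_ge0// sqr_ge0.
rewrite fine_le//; [| |apply: ge0_subset_integral => //].
- by apply: integrable_fin_num => //; exact: integrableS iF'.
- exact: integrable_fin_num.
- exact: measurable_int iF'.
- by move=> x _; rewrite /= lee_fin !mulr_ge0 ?expR_ge0// addr_ge0// sqr_ge0.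
Qed.

End Weight.

(** * Differentiable curves *)

Section Curves.
Context {R : realType}.
Notation leb := (@lebesgue_measure R).

Lemma is_derive_cvg (F : R -> R) (t l : R) :
  h^-1 * (F (t + h) - F t) @[h --> 0^'] --> l -> is_derive t 1 F l.
Proof.
move=> Fl.
have {}Fl : h^-1 *: ((F \o shift t) (h *: 1) - F t) @[h --> 0^'] --> l.
  have -> // : (fun h : R => h^-1 *: ((F \o shift t) (h *: 1) - F t)) =
      (fun h => h^-1 * (F (t + h) - F t)).
  by apply/funext => h; rewrite /GRing.scale/= mulr1 (addrC t).
apply: DeriveDef; first by apply/cvg_ex; exists l.
exact: cvg_lim Fl.
Qed.

Lemma cvg_uniform_derive (A A' : nat -> R -> R) :
  (forall k (t : R), is_derive t 1 (A k) (A' k t)) ->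
  (forall (t e : R), 0 < e -> \forall s \near t & k \near \oo, `|A' k s| < e) ->
  forall s t, A k t - A k s @[k --> \oo] --> 0.
Proof.
move=> dA A0 s t.
apply/cvgrPdist_lt => e e0.
have e1 : 0 < e / (`|t - s| + 1) by rewrite divr_gt0// ltr_wpDl.
have /compact_near_coveringP/(_ nat \oo (fun k z => `|A' k z| < e / (`|t - s| + 1)))
  := @segment_compact R (Num.min s t) (Num.max s t).
move=> /(_ _ (fun z _ => A0 z _ e1)); apply: filterS => k Ak.
have [z zst ->] := mean_value s t (dA k).
rewrite sub0r normrN normrM.
have /= := Ak z; rewrite in_itv/= => /(_ zst).
rewrite ltr_pdivlMr ?ltr_wpDl// => H.
by apply: le_lt_trans H; rewrite ler_wpM2l// lerDl.
Qed.

Definition L2_derivative (X : R -> R -> R) (t : R) (X' : R -> R) : Prop :=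
  n2 (fun xi => h^-1 * (X (t + h) xi - X t xi) - X' xi) @[h --> 0^'] --> 0.

Lemma L2_derivative_continuous X t X' : (forall s, inL2 (X s)) -> inL2 X' ->
  L2_derivative X t X' ->
  forall e, 0 < e -> \forall s \near t, n2 (fun xi => X s xi - X t xi) < e.
Proof.
move=> X2 X'2 dX e e0.
have : \forall h \near 0^', n2 (fun xi => X (t + h) xi - X t xi) < e.
  move/cvgrPdist_lt : dX => /(_ 1 ltr01) dX.
  have eX : 0 < e / (1 + n2 X') by rewrite divr_gt0// ltr_pwDl// n2_ge0.
  near=> h.
  have h0 : h != 0 by near: h; exact: nbhs_dnbhs_neq.
  have h1 : `|h| < e / (1 + n2 X').
    by near: h; exact: dnbhs0_lt.
  have : `|0 - n2 (fun xi => h^-1 * (X (t + h) xi - X t xi) - X' xi)| < 1.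
    by near: h.
  rewrite sub0r normrN ger0_norm ?n2_ge0// => r1.
  have rh : inL2 (fun xi => h^-1 * (X (t + h) xi - X t xi) - X' xi).
    by apply: inL2B => //; apply: inL2Z; exact: inL2B.
  have -> : (fun xi => X (t + h) xi - X t xi) =
     (fun xi => h * (h^-1 * (X (t + h) xi - X t xi) - X' xi + X' xi)).
    by apply/funext => xi; field.
  rewrite n2Z; last exact: inL2D.
  rewrite ltr_pdivlMr in h1; last by rewrite ltr_pwDl// n2_ge0.
  apply: le_lt_trans h1; rewrite ler_wpM2l//.
  by apply: le_trans (n2D rh X'2) _; rewrite lerD2r ltW.
rewrite near_withinE => /nbhs_ballP[d /= d0 H].
apply/nbhs_ballP; exists d => //= s ts.
have [->|st] := eqVneq s t.
  have -> : (fun xi => X t xi - X t xi) = (fun xi => 0 * X t xi).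
    by apply/funext => xi; rewrite subrr mul0r.
  by rewrite n2Z// normr0 mul0r.
have := H (s - t); rewrite (addrC t) subrK; apply; last by rewrite subr_eq0.
by move: ts; rewrite /ball/= sub0r normrN distrC.
Unshelve. all: by end_near. Qed.

Lemma L2_derivative_cvg X t X' : (forall s, inL2 (X s)) -> inL2 X' ->
  L2_derivative X t X' ->
  n2 (fun xi => X (t + h) xi - X t xi) @[h --> 0^'] --> 0.
Proof.
move=> X2 X'2 dX; apply/cvgrPdist_lt => e e0.
have /nbhs_ballP[d /= d0 H] := L2_derivative_continuous X2 X'2 dX e0.
rewrite near_withinE; apply/nbhs_ballP; exists d => //= h.
rewrite /ball/= sub0r normrN => hd _.
rewrite sub0r normrN ger0_norm ?n2_ge0//; apply: H.
by rewrite /ball/= opprD addrA subrr sub0r normrN.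
Qed.

Lemma is_derive_L2_inner (D : set R) X Y t X' Y' : measurable D ->
  (forall s, inL2 (X s)) -> (forall s, inL2 (Y s)) -> inL2 X' -> inL2 Y' ->
  L2_derivative X t X' -> L2_derivative Y t Y' ->
  is_derive t 1 (fun s => \int[leb]_(xi in D) (X s xi * Y s xi))
    (\int[leb]_(xi in D) (X' xi * Y t xi) + \int[leb]_(xi in D) (X t xi * Y' xi)).
Proof.
move=> mD X2 Y2 X'2 Y'2 dX dY; apply: is_derive_cvg.
pose r h xi := h^-1 * (X (t + h) xi - X t xi) - X' xi.
pose q h xi := h^-1 * (Y (t + h) xi - Y t xi) - Y' xi.
have r2 h : inL2 (r h) by apply: inL2B => //; apply: inL2Z; exact: inL2B.
have q2 h : inL2 (q h) by apply: inL2B => //; apply: inL2Z; exact: inL2B.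
have dYt h : inL2 (fun xi => Y (t + h) xi - Y t xi) by exact: inL2B.
pose bnd h := n2 (r h) * (n2 (Y t) + n2 (fun xi => Y (t + h) xi - Y t xi))
  + n2 X' * n2 (fun xi => Y (t + h) xi - Y t xi) + n2 (X t) * n2 (q h).
have r0 : n2 (r h) @[h --> 0^'] --> 0 := dX.
have q0 : n2 (q h) @[h --> 0^'] --> 0 := dY.
have bnd0 : bnd h @[h --> 0^'] --> 0.
  rewrite [X in _ --> X](_ : 0 = 0 * (n2 (Y t) + 0) + n2 X' * 0 + n2 (X t) * 0); last by ring.
  apply: cvgD; first apply: cvgD.
  - apply: cvgM; first exact: r0.
    apply: cvgD; first exact: cvg_cst.
    exact: (L2_derivative_cvg Y2 Y'2 dY).
  - by apply: cvgM; [exact: cvg_cst|exact: (L2_derivative_cvg Y2 Y'2 dY)].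
  - by apply: cvgM; [exact: cvg_cst|exact: q0].
apply/cvgrPdist_lt => e e0.
move/cvgrPdist_lt : bnd0 => /(_ _ e0) bnde.
near=> h.
have h0 : h != 0 by near: h; exact: nbhs_dnbhs_neq.
have be : `|0 - bnd h| < e by near: h.
apply: le_lt_trans be; rewrite sub0r normrN distrC.
apply: le_trans (ler_norm _).
have iM f g : inL2 f -> inL2 g ->
  leb.-integrable D (EFin \o (fun x => f x * g x)) by exact: inL2M_integrable.
have -> : h^-1 * (\int[leb]_(xi in D) (X (t + h) xi * Y (t + h) xi) -
      \int[leb]_(xi in D) (X t xi * Y t xi)) -
    (\int[leb]_(xi in D) (X' xi * Y t xi) + \int[leb]_(xi in D) (X t xi * Y' xi)) =
    \int[leb]_(xi in D) (r h xi * Y (t + h) xi) +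
    \int[leb]_(xi in D) (X' xi * (Y (t + h) xi - Y t xi)) +
    \int[leb]_(xi in D) (X t xi * q h xi).
  have E1 : \int[leb]_(xi in D) (r h xi * Y (t + h) xi) =
      h^-1 * (\int[leb]_(xi in D) (X (t + h) xi * Y (t + h) xi) -
        \int[leb]_(xi in D) (X t xi * Y (t + h) xi)) -
      \int[leb]_(xi in D) (X' xi * Y (t + h) xi).
    rewrite -RintegralB//; [|exact: iM|exact: iM].
    rewrite -RintegralZl//; last exact: (integrableB _ (iM _ _ (X2 _) (Y2 _)) (iM _ _ (X2 _) (Y2 _))).
    rewrite -RintegralB//; last exact: iM.
      by apply: eq_Rintegral => xi _; rewrite /r; ring.
    exact: (integrableZl _ _ (integrableB _ (iM _ _ (X2 _) (Y2 _)) (iM _ _ (X2 _) (Y2 _)))).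
  have E2 : \int[leb]_(xi in D) (X' xi * (Y (t + h) xi - Y t xi)) =
      \int[leb]_(xi in D) (X' xi * Y (t + h) xi) - \int[leb]_(xi in D) (X' xi * Y t xi).
    rewrite -RintegralB//; [|exact: iM|exact: iM].
    by apply: eq_Rintegral => xi _; ring.
  have E3 : \int[leb]_(xi in D) (X t xi * q h xi) =
      h^-1 * (\int[leb]_(xi in D) (X t xi * Y (t + h) xi) -
        \int[leb]_(xi in D) (X t xi * Y t xi)) -
      \int[leb]_(xi in D) (X t xi * Y' xi).
    rewrite -RintegralB//; [|exact: iM|exact: iM].
    rewrite -RintegralZl//; last exact: (integrableB _ (iM _ _ (X2 _) (Y2 _)) (iM _ _ (X2 _) (Y2 _))).
    rewrite -RintegralB//; last exact: iM.
      by apply: eq_Rintegral => xi _; rewrite /q; ring.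
    exact: (integrableZl _ _ (integrableB _ (iM _ _ (X2 _) (Y2 _)) (iM _ _ (X2 _) (Y2 _)))).
  by rewrite E1 E2 E3; ring.
apply: le_trans (ler_normD _ _) _; apply: lerD; last exact: normr_Rintegral_le.
apply: le_trans (ler_normD _ _) _; apply: lerD; last exact: normr_Rintegral_le.
apply: le_trans (normr_Rintegral_le _ _ _) _ => //.
by rewrite ler_wpM2l ?n2_ge0//; exact: n2_trans.
Unshelve. all: by end_near. Qed.

End Curves.

(** * The pressure in Lagrangian variables *)

Section NonMeasurable.
Import HBNNSimple.
Context {R : realType}.
Notation leb := (@lebesgue_measure R).

Lemma ge0_ae_le_integral (f g : R -> \bar R) :
  (forall x, 0 <= f x)%E -> (forall x, 0 <= g x)%E ->
  {ae leb, forall x, f x = g x} -> (\int[leb]_x f x <= \int[leb]_x g x)%E.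
Proof.
move=> f0 g0 [N [mN N0 fgN]].
rewrite !ge0_integralTE//; apply: ge_ereal_sup => _ [h /= hf <-].
apply: ereal_sup_ubound; exists (proj_nnsfun h (measurableC mN)).
  move=> x; rewrite /= /mindic indicE; have [xN|xN] := boolP (x \in ~` N).
    rewrite mulr1; suff <- : f x = g x by exact: hf.
    by apply: contrapT => fgx; move: xN; rewrite inE; apply; exact: fgN.
  by rewrite mulr0.
rewrite -!integralT_nnsfun; apply: ge0_ae_eq_integral => //.
- by apply/measurable_EFinP; exact: measurable_funP.
- by apply/measurable_EFinP; exact: measurable_funP.
- by move=> x _; rewrite lee_fin fun_ge0.
- by move=> x _; rewrite lee_fin fun_ge0.
- exists N; split => // x /=; apply: contra_notP => xN _.
  by rewrite /mindic indicE mem_set// mulr1.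
Qed.

Lemma ge0_ae_eq_integralT (f g : R -> \bar R) :
  (forall x, 0 <= f x)%E -> (forall x, 0 <= g x)%E ->
  {ae leb, forall x, f x = g x} -> (\int[leb]_x f x = \int[leb]_x g x)%E.
Proof.
move=> f0 g0 fg; apply/eqP; rewrite eq_le !ge0_ae_le_integral//.
by apply: aeS fg => x /= ->.
Qed.

(* Neither [f] nor [g] needs to be measurable: this matters for [derive1 y],
   whose measurability is not obvious at the points where [y] is not
   differentiable. *)
Lemma ae_eq_Rintegral (f g : R -> R) : {ae leb, forall x, f x = g x} ->
  \int[leb]_x f x = \int[leb]_x g x.
Proof.
move=> fg; rewrite /Rintegral integralE [in RHS]integralE.
congr (fine (_ - _)%E); apply: ge0_ae_eq_integralT.
- by move=> x; exact: funepos_ge0.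
- by move=> x; exact: funepos_ge0.
- by apply: aeS fg => x /= fgx; rewrite !funeposE /= fgx.
- by move=> x; exact: funeneg_ge0.
- by move=> x; exact: funeneg_ge0.
- by apply: aeS fg => x /= fgx; rewrite !funenegE /= fgx.
Qed.

Lemma Rintegral_splitT (g : R -> R) (x : R) : leb.-integrable setT (EFin \o g) ->
  \int[leb]_t g t =
  \int[leb]_(t in `]-oo, x[) g t + \int[leb]_(t in `]x, +oo[) g t.
Proof.
move=> ig.
rewrite Rintegral_itv_bndo_bndc; last exact: integrableS ig.
rewrite -Rintegral_setU//.
- by rewrite -itv_bndbnd_setU// set_itvNyy.
- by apply: integrableS ig => //; exact: measurableU.
- apply/disj_setPS => t [/=]; rewrite !in_itv/= andbT => tx xt.
  by move: tx; rewrite leNgt xt.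
Qed.

End NonMeasurable.

Section Static.
Context {R : realType} (y U H : R -> R).
Notation leb := (@lebesgue_measure R).
Hypotheses (Zy : inV (fun x => y x - x)) (HU : inH1 U) (VH : inV H).

Let Z' := derive1 (fun x => y x - x).
Let H' := derive1 H.

Lemma inV_primitive (f : R -> R) : inV f -> primitive f (derive1 f).
Proof. by case. Qed.

Lemma inH1_primitive (f : R -> R) : inH1 f -> primitive f (derive1 f).
Proof. by case. Qed.

Lemma inV_L2 (f : R -> R) : inV f -> inL2 (derive1 f).
Proof. by case. Qed.

Lemma inH1_bounded (f : R -> R) : inH1 f ->
  forall x, `|f x| <= 1 + 2 * expR 1 * (n2 f ^+ 2 + n2 (derive1 f) ^+ 2).
Proof.
move=> [pf f2 f'2] x.
apply: (@le_trans _ _ (1 + f x ^+ 2)).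
  by rewrite -real_normK ?num_real//; have := normr_ge0 (f x); nra.
rewrite lerD2l; apply: le_trans (primitive_sqr_le_wn x pf f2 f'2) _.
rewrite ler_pM2l; last by rewrite mulr_gt0// expR_gt0.
by rewrite lerD// lerXn2r ?nnegrE ?wn_ge0 ?n2_ge0 ?wn_le.
Qed.

Lemma primitive_char : primitive y (fun x => 1 + Z' x).
Proof.
have := primitiveD (@primitive_id R) (inV_primitive Zy).
by congr primitive; apply/funext => x /=; ring.
Qed.

Lemma ae_derive1_char : {ae leb, forall x, derive1 y x = 1 + Z' x}.
Proof. exact: (primitive_derive1 primitive_char). Qed.

Let f0 x := U x ^+ 2 * (1 + Z' x) + H' x.
Let K xi eta := expR (- Num.sg (xi - eta) * (y xi - y eta)).

Lemma lagPE xi : lagP y U H xi = 4^-1 * \int[leb]_eta (K xi eta * f0 eta).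
Proof.
rewrite /lagP; congr (_ * _); apply: ae_eq_Rintegral.
by apply: aeS ae_derive1_char => x /= ->.
Qed.

Lemma lagQE xi : lagQ y U H xi =
  - (4^-1 * \int[leb]_eta (Num.sg (xi - eta) * K xi eta * f0 eta)).
Proof.
rewrite /lagQ; congr (- (_ * _)); apply: ae_eq_Rintegral.
by apply: aeS ae_derive1_char => x /= ->.
Qed.

Let loc_f0 : locally_integrable setT f0.
Proof.
apply: locally_integrableD; last by case: (inV_primitive VH).
apply: locally_integrableM; last by case: primitive_char.
exact: (primitive_continuous (primitive_sqr (inH1_primitive HU))).
Qed.

Lemma measurable_kernel xi : measurable_fun setT (K xi).
Proof.
have my : measurable_fun setT y.
  by apply: continuous_measurable_fun; exact: (primitive_continuous primitive_char).
apply: measurableT_comp => //; apply: measurable_funM.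
  have := measurable_sg xi; congr measurable_fun; apply/funext => x.
  by rewrite -sgrN opprB.
exact: measurable_funB.
Qed.

Lemma kernel_le M xi eta : (forall x, `|y x - x| <= M) ->
  K xi eta <= expR (2 * M) * wgt xi eta ^+ 2.
Proof.
move=> yM; rewrite wgt_sqr -expRD ler_expR.
have -> : - Num.sg (xi - eta) * (y xi - y eta) = - `|xi - eta| -
   Num.sg (xi - eta) * ((y xi - xi) - (y eta - eta)).
  by rewrite normrEsg; ring.
rewrite addrC lerD2r; apply: le_trans (ler_norm _) _; rewrite normrN normrM normr_sg.
have : `|y xi - xi - (y eta - eta)| <= 2 * M.
  apply: le_trans (ler_normB _ _) _.
  by rewrite mulr2n mulrDl mul1r lerD.
by move=> h; have := normr_ge0 (y xi - xi - (y eta - eta)); case: (_ != _) => /=; lra.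
Qed.

Section Bound.
Variable S : R.
Hypothesis US : forall x, `|U x| <= S.

Let U2 : inL2 U. Proof. by case: HU. Qed.
Let H'2 : inL2 H'. Proof. by case: VH. Qed.
Let Z'2 : inL2 Z'. Proof. by case: Zy. Qed.

Let UZ2 : inL2 (fun x => U x * Z' x).
Proof.
apply: (@inL2_le _ _ (fun x => S * Z' x)); last exact: inL2Z.
  by apply: measurable_funM; exact: inL2_measurable.
move=> x; rewrite !normrM ler_wpM2r//.
by apply: le_trans (US x) _; exact: ler_norm.
Qed.

Let wn_UZ xi : wn xi (fun x => U x * Z' x) <= S * wn xi Z'.
Proof.
have S0 : 0 <= S by apply: le_trans (US 0); exact: normr_ge0.
rewrite -[S in leRHS]ger0_norm// -n2Z; last exact: inL2_wgtM.
apply: n2_le; last by apply: inL2Z; exact: inL2_wgtM.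
  by apply: measurable_funM; [exact: measurable_wgt|exact: inL2_measurable].
move=> x; rewrite mulrCA normrM [leRHS]normrM ler_wpM2r//.
by apply: le_trans (US x) _; exact: ler_norm.
Qed.

Let f0E xi eta : wgt xi eta ^+ 2 * f0 eta =
  (wgt xi eta * U eta) * (wgt xi eta * U eta) +
  (wgt xi eta * U eta) * (wgt xi eta * (U eta * Z' eta)) +
  wgt xi eta * (wgt xi eta * H' eta).
Proof. by rewrite /f0; ring. Qed.

Let wU xi := inL2_wgtM xi U2.
Let wUZ xi := inL2_wgtM xi UZ2.
Let wH xi := inL2_wgtM xi H'2.
Let w1 xi := (@inL2_wgt R xi).1.

Lemma integrable_wgt_source xi :
  leb.-integrable setT (EFin \o (fun eta => wgt xi eta ^+ 2 * f0 eta)).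
Proof.
have i1 := inL2M_integrable measurableT (wU xi) (wU xi).
have i2 := inL2M_integrable measurableT (wU xi) (wUZ xi).
have i3 := inL2M_integrable measurableT (w1 xi) (wH xi).
apply: eq_integrable (integrableD measurableT (integrableD measurableT i1 i2) i3) => //.
by move=> eta _; rewrite /= f0E !EFinD.
Qed.

Lemma Rintegral_wgt_source xi :
  \int[leb]_eta `|wgt xi eta ^+ 2 * f0 eta| <=
  wn xi U ^+ 2 + S * (wn xi U * wn xi Z') + 2 * wn xi H'.
Proof.
have i1 := inL2M_integrable measurableT (wU xi) (wU xi).
have i2 := inL2M_integrable measurableT (wU xi) (wUZ xi).
have i3 := inL2M_integrable measurableT (w1 xi) (wH xi).
have n1 := integrable_norm i1; have nn2 := integrable_norm i2; have n3 := integrable_norm i3.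
apply: (@le_trans _ _ (\int[leb]_eta (`|(wgt xi eta * U eta) * (wgt xi eta * U eta)| +
  `|(wgt xi eta * U eta) * (wgt xi eta * (U eta * Z' eta))| +
  `|wgt xi eta * (wgt xi eta * H' eta)|))).
  apply: le_Rintegral => //.
  - exact: integrable_norm (integrable_wgt_source xi).
  - exact: (integrableD _ (integrableD _ n1 nn2) n3).
  - move=> eta _; rewrite f0E; apply: le_trans (ler_normD _ _) _.
    by rewrite lerD2r; exact: ler_normD.
rewrite RintegralD//; last exact: (integrableD _ n1 nn2).
rewrite RintegralD//.
apply: lerD; first apply: lerD.
- by apply: le_trans (Rintegral_abs_le _ (wU xi) (wU xi)) _ => //; rewrite expr2.
- apply: le_trans (Rintegral_abs_le _ (wU xi) (wUZ xi)) _ => //.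
  by rewrite mulrCA ler_wpM2l ?n2_ge0//; exact: wn_UZ.
- apply: le_trans (Rintegral_abs_le _ (w1 xi) (wH xi)) _ => //.
  by rewrite ler_wpM2r ?n2_ge0//; exact: (inL2_wgt xi).2.
Qed.

Lemma integrable_kernel_source xi :
  leb.-integrable setT (EFin \o (fun eta => K xi eta * f0 eta)).
Proof.
have [_ [M yM] _ _] := Zy.
have : leb.-integrable setT
    (EFin \o (fun eta => expR (2 * M) * (wgt xi eta ^+ 2 * f0 eta))).
  exact: (integrableZl measurableT (expR (2 * M)) (integrable_wgt_source xi)).
apply: le_integrable => //.
  apply/measurable_EFinP/measurable_funM; first exact: measurable_kernel.
  by case: loc_f0.
move=> eta _ /=; rewrite lee_fin mulrA !normrM ler_wpM2r//.
rewrite ger0_norm ?expR_ge0// ger0_norm ?expR_ge0// ger0_norm ?(ltW (wgt_gt0 _ _))//.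
exact: kernel_le.
Qed.

Lemma lagP_le M xi : (forall x, `|y x - x| <= M) ->
  `|lagP y U H xi| <= 4^-1 * (expR (2 * M) *
     (wn xi U ^+ 2 + S * (wn xi U * wn xi Z') + 2 * wn xi H')).
Proof.
move=> yM; rewrite lagPE normrM ger0_norm ?invr_ge0// ler_pM2l ?invr_gt0//.
have iK := integrable_kernel_source xi.
apply: le_trans (le_normr_Rintegral _ iK) _ => //.
apply: le_trans (ler_wpM2l (expR_ge0 _) (Rintegral_wgt_source xi)).
have iw := integrable_norm (integrable_wgt_source xi).
rewrite -RintegralZl//; apply: le_Rintegral => //.
- exact: integrable_norm iK.
- exact: (integrableZl _ _ iw).
- move=> eta _; rewrite !normrM mulrA ler_wpM2r//.
  rewrite ger0_norm ?expR_ge0// ger0_norm ?(ltW (wgt_gt0 _ _))//.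
  exact: kernel_le.
Qed.

End Bound.

Let G1 xi := \int[leb]_(eta in `]-oo, xi]) (expR (y eta) * f0 eta).
Let G2 xi := \int[leb]_(eta in `]xi, +oo[) (expR (- y eta) * f0 eta).

Let kernel_lt xi eta : eta <= xi -> K xi eta = expR (- y xi) * expR (y eta).
Proof.
rewrite le_eqVlt /K => /predU1P[->|ex].
  by rewrite !subrr mulr0 -expRD addNr.
by rewrite gtr0_sg ?subr_gt0// -expRD mulN1r opprB addrC.
Qed.

Let kernel_gt xi eta : xi < eta -> K xi eta = expR (y xi) * expR (- y eta).
Proof.
by move=> xe; rewrite /K ltr0_sg ?subr_lt0// -expRD opprK mul1r.
Qed.

Let iK xi := integrable_kernel_source (inH1_bounded HU) xi.

Let integrable_left xi : leb.-integrable `]-oo, xi]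
  (EFin \o (fun eta => expR (y eta) * f0 eta)).
Proof.
have iKl : leb.-integrable `]-oo, xi] (EFin \o (fun eta => K xi eta * f0 eta)).
  exact: integrableS (iK xi).
apply: eq_integrable (integrableZl _ (expR (y xi)) iKl) => //.
move=> eta; rewrite inE/= in_itv/= => ex.
by rewrite -EFinM kernel_lt// !mulrA -expRD subrr expR0 mul1r.
Qed.

Let integrable_right xi : leb.-integrable `]xi, +oo[
  (EFin \o (fun eta => expR (- y eta) * f0 eta)).
Proof.
have iKr : leb.-integrable `]xi, +oo[ (EFin \o (fun eta => K xi eta * f0 eta)).
  exact: integrableS (iK xi).
apply: eq_integrable (integrableZl _ (expR (- y xi)) iKr) => //.
move=> eta; rewrite inE/= in_itv/= andbT => ex.
by rewrite -EFinM kernel_gt// !mulrA -expRD addNr expR0 mul1r.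
Qed.

Let int_left xi c : \int[leb]_(eta in `]-oo, xi[) (c * (expR (y eta) * f0 eta)) = c * G1 xi.
Proof.
rewrite RintegralZl//.
  rewrite Rintegral_itv_bndo_bndc//; apply: integrableS (integrable_left xi) => //.
  by move=> t /=; rewrite !in_itv/=; exact: ltW.
apply: integrableS (integrable_left xi) => //.
by move=> t /=; rewrite !in_itv/=; exact: ltW.
Qed.

Let int_right xi c : \int[leb]_(eta in `]xi, +oo[) (c * (expR (- y eta) * f0 eta)) = c * G2 xi.
Proof. by rewrite RintegralZl. Qed.

Lemma lagP_split xi :
  lagP y U H xi = 4^-1 * (expR (- y xi) * G1 xi + expR (y xi) * G2 xi).
Proof.
rewrite lagPE (Rintegral_splitT xi)//; congr (_ * (_ + _)).
  rewrite -int_left; apply: eq_Rintegral => eta; rewrite inE/= in_itv/= => ex.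
  by rewrite kernel_lt ?ltW// mulrA.
rewrite -int_right; apply: eq_Rintegral => eta; rewrite inE/= in_itv/= andbT => ex.
by rewrite kernel_gt// mulrA.
Qed.

Lemma lagQ_split xi :
  lagQ y U H xi = - (4^-1 * (expR (- y xi) * G1 xi - expR (y xi) * G2 xi)).
Proof.
rewrite lagQE (Rintegral_splitT xi).
  congr (- (_ * (_ + _))).
    rewrite -int_left; apply: eq_Rintegral => eta; rewrite inE/= in_itv/= => ex.
    by rewrite kernel_lt ?ltW// gtr0_sg ?subr_gt0// mul1r mulrA.
  rewrite -mulNr -int_right; apply: eq_Rintegral => eta; rewrite inE/= in_itv/= andbT => ex.
  by rewrite kernel_gt// ltr0_sg ?subr_lt0//; ring.
apply: le_integrable (iK xi) => //.
  apply/measurable_EFinP/measurable_funM; last by case: loc_f0.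
  apply: measurable_funM; last exact: measurable_kernel.
  have := measurable_sg xi => /(measurableT_comp (@oppr_measurable R setT)).
  by congr measurable_fun; apply/funext => x /=; rewrite -sgrN opprB.
move=> eta _ /=; rewrite lee_fin !normrM normr_sg -mulrA.
by case: (_ != _); rewrite ?mul1r ?mul0r ?mulr_ge0.
Qed.

Let loc_exp_f0 c : locally_integrable setT (fun x => expR (c * y x) * f0 x).
Proof.
apply: locally_integrableM => //.
exact: (primitive_continuous (primitive_expR (primitiveZ c primitive_char))).
Qed.

Let primitive_G1 : primitive G1 (fun x => expR (y x) * f0 x).
Proof.
split; first by have := loc_exp_f0 1; under eq_fun do rewrite mul1r.
move=> a b ab; rewrite Rintegral_itvB ?bnd_simp//.
rewrite Rintegral_itv_obnd_cbnd//; apply: integrableS (integrable_left b) => //.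
by move=> t /=; rewrite !in_itv/= => /andP[].
Qed.

Let primitive_G2 : primitive G2 (fun x => - (expR (- y x) * f0 x)).
Proof.
have l2 : locally_integrable setT (fun x => expR (- y x) * f0 x).
  by have := loc_exp_f0 (-1); under eq_fun do rewrite mulN1r.
split; first exact: locally_integrableN.
move=> a b ab.
have -> : \int[leb]_(x in `[a, b]) (- (expR (- y x) * f0 x)) =
    - \int[leb]_(x in `[a, b]) (expR (- y x) * f0 x).
  under eq_Rintegral do rewrite -mulN1r.
  by rewrite RintegralZl ?mulN1r//; exact: locally_integrable_itv.
rewrite -Rintegral_itv_obnd_cbnd; last first.
  apply: integrableS (integrable_right a) => //.
  by move=> t /=; rewrite !in_itv/= => /andP[->].
rewrite /G2 -(@Rintegral_itvB R _ (BRight a) +oo%O b) ?bnd_simp//.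
by ring.
Qed.

(* The identity P_xi = Q y_xi. *)
Lemma primitive_lagP :
  primitive (lagP y U H) (fun xi => lagQ y U H xi * (1 + Z' xi)).
Proof.
have pm := primitiveM (primitive_expR (primitiveZ (-1) primitive_char)) primitive_G1.
have pp := primitiveM (primitive_expR primitive_char) primitive_G2.
have := primitiveZ 4^-1 (primitiveD pm pp).
congr primitive; apply/funext => xi.
  by rewrite lagP_split mulN1r.
by rewrite lagQ_split !mulN1r; ring.
Qed.

End Static.

(** * The Lagrangian flow *)

Section DerivativeIn.
Context {R : realType}.
Notation leb := (@lebesgue_measure R).

Lemma ae_eq_n2 (f g : R -> R) : {ae leb, forall x, f x = g x} -> n2 f = n2 g.
Proof.
move=> fg; rewrite /n2 unlock /=; congr (fine (_ `^ _)%E).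
apply: ge0_ae_eq_integralT => [x|x|]; rewrite ?poweR_ge0//.
by apply: aeS fg => x /= ->.
Qed.

Lemma cvge0_addl (F : set_system R) (a b : R -> \bar R) : Filter F ->
  (forall h, 0 <= a h)%E -> (forall h, 0 <= b h)%E ->
  (a h + b h)%E @[h --> F] --> 0%E -> a @ F --> 0%E.
Proof.
move=> FF a0 b0 ab; apply: squeeze_cvge ab; last exact: cvg_cst.
by apply: nearW => h; rewrite a0/= leeDl.
Qed.

Lemma sup_norm_ge0 (f : R -> R) : (0 <= ereal_sup (range (fun x => `|f x|%:E)))%E.
Proof.
apply: (@le_trans _ _ `|f 0|%:E); first by rewrite lee_fin.
by apply: ereal_sup_ubound; exists 0.
Qed.

Lemma Lnorm2_cvg (X : R -> R -> R) :
  ('N[leb]_2[EFin \o X h])%E @[h --> 0^'] --> 0%E -> n2 (X h) @[h --> 0^'] --> 0.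
Proof. by move=> /fine_cvg; exact. Qed.

Section InV.
Variables (X : R -> R -> R) (t : R) (X' : R -> R).
Hypothesis VX : forall s, inV (X s).
Hypothesis dX : derivative_in inV normV X t X'.

Let r h xi := h^-1 * (X (t + h) xi - X t xi) - X' xi.

Lemma derivative_inV_sup :
  ereal_sup (range (fun x => `|r h x|%:E)) @[h --> 0^'] --> 0%E.
Proof.
have [_ nX] := dX.
by apply: (@cvge0_addl _ (fun h => ereal_sup (range (fun x => `|r h x|%:E)))
  (fun h => 'N[leb]_2[EFin \o derive1 (r h)])%E _ _ _ nX) => h;
  [exact: sup_norm_ge0|exact: Lnorm_ge0].
Qed.

Lemma derivative_inV_near e : 0 < e -> \forall h \near 0^', forall xi, `|r h xi| < e.
Proof.
move=> e0; have /fine_cvgP[fin_sup /cvgrPdist_lt/(_ _ e0) lt_sup] := derivative_inV_sup.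
apply: filterS2 fin_sup lt_sup => h hfin; rewrite sub0r normrN /= => hs xi.
apply: le_lt_trans hs; apply: le_trans (ler_norm _).
by rewrite -lee_fin fineK//; apply: ereal_sup_ubound; exists xi.
Qed.

Lemma derivative_inV_is_derive xi : is_derive t 1 (fun s => X s xi) (X' xi).
Proof.
apply: is_derive_cvg; apply/cvgrPdist_lt => e e0.
by apply: filterS (derivative_inV_near e0) => h /(_ xi); rewrite distrC.
Qed.

Lemma derivative_inV_L2 :
  L2_derivative (fun s => derive1 (X s)) t (derive1 X').
Proof.
have [VX' nX] := dX.
have : n2 (derive1 (r h)) @[h --> 0^'] --> 0.
  apply: Lnorm2_cvg.
  have {}nX : normV (r h) @[h --> 0^'] --> 0%E by exact: nX.
  move: nX; rewrite /normV; under eq_fun do rewrite addeC.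
  move=> nX.
  by apply: (@cvge0_addl _ (fun h => 'N[leb]_2[EFin \o derive1 (r h)])%E
    (fun h => ereal_sup (range (fun x => `|r h x|%:E))) _ _ _ nX) => h;
    [exact: Lnorm_ge0|exact: sup_norm_ge0].
rewrite /L2_derivative; suff -> : (fun h => n2 (fun xi =>
    h^-1 * (derive1 (X (t + h)) xi - derive1 (X t) xi) - derive1 X' xi)) =
  (fun h => n2 (derive1 (r h))) by [].
apply/funext => h; apply/esym.
apply: ae_eq_n2; apply: primitive_derive1.
apply: primitiveB; last exact: inV_primitive.
by apply: primitiveZ; apply: primitiveB; exact: inV_primitive.
Qed.

Lemma inV_locally_bounded : exists M, \forall s \near t, forall xi, `|X s xi| <= M.
Proof.
have [[_ [B X'B] _ _] _] := dX.
have [_ [M XM] _ _] := VX t.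
have B0 : 0 <= B by apply: le_trans (X'B 0); exact: normr_ge0.
have M0 : 0 <= M by apply: le_trans (XM 0); exact: normr_ge0.
exists (M + (1 + B)).
have : \forall h \near 0^', forall xi, `|X (t + h) xi| <= M + (1 + B).
  near=> h => xi.
  have h0 : h != 0 by near: h; exact: nbhs_dnbhs_neq.
  have h1 : `|h| < 1 by near: h; exact: dnbhs0_lt.
  have rh : `|r h xi| < 1.
    by move: xi; near: h; exact: derivative_inV_near.
  have -> : X (t + h) xi = X t xi + h * (r h xi + X' xi) by rewrite /r; field.
  apply: le_trans (ler_normD _ _) _; apply: lerD; first exact: XM.
  rewrite normrM; apply: (@le_trans _ _ (1 * (1 + B))); last by rewrite mul1r.
  apply: ler_pM => //; first exact: ltW.
  by apply: le_trans (ler_normD _ _) _; apply: lerD; [exact: ltW|exact: X'B].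
rewrite near_withinE => /nbhs_ballP[d /= d0 Hd].
apply/nbhs_ballP; exists d => //= s ts xi.
have [->|st] := eqVneq s t; first by apply: le_trans (XM xi) _; rewrite lerDl addr_ge0.
have := Hd (s - t); rewrite (addrC t) subrK; apply; last by rewrite subr_eq0.
by move: ts; rewrite /ball/= sub0r normrN distrC.
Unshelve. all: by end_near. Qed.

End InV.

Section InH1.
Variables (X : R -> R -> R) (t : R) (X' : R -> R).
Hypothesis HX : forall s, inH1 (X s).
Hypothesis dX : derivative_in inH1 normH1 X t X'.

Let r h xi := h^-1 * (X (t + h) xi - X t xi) - X' xi.

Lemma derivative_inH1_L2 : L2_derivative X t X'.
Proof.
have [_ nX] := dX; apply: Lnorm2_cvg.
by apply: (@cvge0_addl _ (fun h => 'N[leb]_2[EFin \o r h])%E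
  (fun h => 'N[leb]_2[EFin \o derive1 (r h)])%E _ _ _ nX) => h; exact: Lnorm_ge0.
Qed.

Lemma derivative_inH1_L2_derive1 :
  L2_derivative (fun s => derive1 (X s)) t (derive1 X').
Proof.
have [HX' nX] := dX.
have : n2 (derive1 (r h)) @[h --> 0^'] --> 0.
  apply: Lnorm2_cvg.
  have {}nX : normH1 (r h) @[h --> 0^'] --> 0%E by exact: nX.
  move: nX; rewrite /normH1; under eq_fun do rewrite addeC.
  move=> nX.
  by apply: (@cvge0_addl _ (fun h => 'N[leb]_2[EFin \o derive1 (r h)])%E
    (fun h => 'N[leb]_2[EFin \o r h])%E _ _ _ nX) => h; exact: Lnorm_ge0.
rewrite /L2_derivative; suff -> : (fun h => n2 (fun xi =>
    h^-1 * (derive1 (X (t + h)) xi - derive1 (X t) xi) - derive1 X' xi)) =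
  (fun h => n2 (derive1 (r h))) by [].
apply/funext => h; apply/esym.
apply: ae_eq_n2; apply: primitive_derive1.
apply: primitiveB; last exact: inH1_primitive.
by apply: primitiveZ; apply: primitiveB; exact: inH1_primitive.
Qed.

End InH1.

Lemma wn_locally_small (X : R -> R -> R) (t : R) (b : nat -> R) :
  (forall s, inL2 (X s)) -> (forall k, `|b k| = k%:R) ->
  (forall e, 0 < e -> \forall s \near t, n2 (fun xi => X s xi - X t xi) < e) ->
  forall e, 0 < e -> \forall s \near t & k \near \oo, wn (b k) (X s) < e.
Proof.
move=> X2 bk cX e e0; have e2 : 0 < e / 2 by rewrite divr_gt0.
have wX : \forall k \near \oo, wn (b k) (X t) < e / 2.
  move/cvgrPdist_lt : (wn_cvg bk (X2 t)) => /(_ _ e2).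
  by apply: filterS => k; rewrite sub0r normrN ger0_norm// wn_ge0.
have cXe := cX _ e2.
near=> s k.
apply: le_lt_trans (wn_trans (b k) (X2 s) (X2 t)) _.
rewrite [e]splitr; apply: ltrD; first by near: k.
by near: s.
Unshelve. all: by end_near. Qed.

End DerivativeIn.

Section Dynamics.
Context {R : realType} (y U H : R -> R -> R).
Notation leb := (@lebesgue_measure R).
Hypothesis sol : lagrangian_solution y U H.

Let Z t xi := y t xi - xi.
Let Z' t := derive1 (Z t).
Let U' t := derive1 (U t).
Let H' t := derive1 (H t).
Let P t := lagP (y t) (U t) (H t).
Let Q t := lagQ (y t) (U t) (H t).

Let VZ t : inV (Z t). Proof. by have [[]] := sol t. Qed.
Let HU t : inH1 (U t). Proof. by have [[]] := sol t. Qed.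
Let VH t : inV (H t). Proof. by have [[]] := sol t. Qed.
Let dZ t : derivative_in inV normV Z t (U t). Proof. by have [_ []] := sol t. Qed.
Let dU t : derivative_in inH1 normH1 U t (fun xi => - Q t xi).
Proof. by have [_ []] := sol t. Qed.
Let dH t : derivative_in inV normV H t (fun xi => U t xi ^+ 3 - 2 * P t xi * U t xi).
Proof. by have [_ []] := sol t. Qed.

Let U2 t : inL2 (U t). Proof. by have [] := HU t. Qed.
Let U'2 t : inL2 (U' t). Proof. by have [] := HU t. Qed.
Let Z'2 t : inL2 (Z' t). Proof. exact: inV_L2. Qed.
Let H'2 t : inL2 (H' t). Proof. exact: inV_L2. Qed.

Let cU t e : 0 < e -> \forall s \near t, n2 (fun xi => U s xi - U t xi) < e.
Proof.
apply: (L2_derivative_continuous U2 _ (derivative_inH1_L2 (dU t))).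
by case: (dU t) => -[].
Qed.

Let cU' t e : 0 < e -> \forall s \near t, n2 (fun xi => U' s xi - U' t xi) < e.
Proof.
apply: (L2_derivative_continuous U'2 _ (derivative_inH1_L2_derive1 HU (dU t))).
by case: (dU t) => -[].
Qed.

Let cZ' t e : 0 < e -> \forall s \near t, n2 (fun xi => Z' s xi - Z' t xi) < e.
Proof.
apply: (L2_derivative_continuous Z'2 _ (derivative_inV_L2 VZ (dZ t))).
exact: U'2.
Qed.

Let cH' t e : 0 < e -> \forall s \near t, n2 (fun xi => H' s xi - H' t xi) < e.
Proof.
apply: (L2_derivative_continuous H'2 _ (derivative_inV_L2 VH (dH t))).
by case: (dH t) => -[].
Qed.

Lemma velocity_locally_bounded (t : R) :
  exists S, \forall s \near t, forall xi, `|U s xi| <= S.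
Proof.
exists (1 + 2 * expR 1 * ((n2 (U t) + 1) ^+ 2 + (n2 (U' t) + 1) ^+ 2)).
apply: filterS2 (cU t ltr01) (cU' t ltr01) => s Us Us' xi.
apply: le_trans (inH1_bounded (HU s) xi) _.
rewrite lerD2l ler_pM2l; last by rewrite mulr_gt0// expR_gt0.
have nU : n2 (U s) <= n2 (U t) + 1.
  by apply: le_trans (n2_trans (U2 s) (U2 t)) _; rewrite lerD2l ltW.
have nU' : n2 (U' s) <= n2 (U' t) + 1.
  by apply: le_trans (n2_trans (U'2 s) (U'2 t)) _; rewrite lerD2l ltW.
by apply: lerD; rewrite lerXn2r ?nnegrE ?addr_ge0 ?n2_ge0.
Qed.

Section Decay.
Variables (b : nat -> R).
Hypothesis bk : forall k, `|b k| = k%:R.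

Lemma velocity_locally_small (t e : R) : 0 < e ->
  \forall s \near t & k \near \oo, `|U s (b k)| < e.
Proof.
move=> e0; set C := 4 * expR 1 : R.
have C1 : 1 < C by have := @expR_ge1Dx R 1; rewrite /C; lra.
have d0 : 0 < e / C by rewrite divr_gt0//; lra.
have wU := wn_locally_small U2 bk (@cU t) d0.
have wU' := wn_locally_small U'2 bk (@cU' t) d0.
apply: filterS2 wU wU' => -[s k] /= ws ws'.
rewrite -(@ltr_pXn2r _ 2) ?nnegrE ?normr_ge0 ?ltW// real_normK ?num_real//.
apply: le_lt_trans (primitive_sqr_le_wn (b k) (inH1_primitive (HU s)) (U2 s) (U'2 s)) _.
apply: (@le_lt_trans _ _ (2 * expR 1 * ((e / C) ^+ 2 + (e / C) ^+ 2))).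
  rewrite ler_pM2l; last by rewrite mulr_gt0// expR_gt0.
  by apply: lerD; rewrite lerXn2r ?nnegrE ?wn_ge0 ?ltW.
have -> : 2 * expR 1 * ((e / C) ^+ 2 + (e / C) ^+ 2) = e ^+ 2 / C.
  have E0 : expR 1 != 0 :> R by rewrite gt_eqF ?expR_gt0.
  by rewrite /C; field.
by rewrite ltr_pdivrMr ?ltr_pMr ?exprn_gt0//; lra.
Qed.

Lemma pressure_locally_small (t e : R) : 0 < e ->
  \forall s \near t & k \near \oo, `|P s (b k)| < e.
Proof.
move=> e0.
have [M ZM] := inV_locally_bounded VZ (dZ t).
have [S US] := velocity_locally_bounded t.
have S0 : 0 <= S.
  have := nbhs_singleton US => /(_ 0); apply: le_trans; exact: normr_ge0.
set C := expR (2 * M) * (3 + S).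
have C0 : 0 < C by rewrite mulr_gt0 ?expR_gt0//; lra.
set d := Num.min 1 (e / C).
have d0 : 0 < d by rewrite lt_min ltr01 divr_gt0.
have wU := wn_locally_small U2 bk (@cU t) d0.
have wZ := wn_locally_small Z'2 bk (@cZ' t) d0.
have wH := wn_locally_small H'2 bk (@cH' t) d0.
have nearl (A : set R) : (\forall s \near t, A s) ->
    \forall s \near t & k \near \oo, A s.
  by move=> As; exists (A, setT) => //=; [split => //; exact: filterT|move=> [s' k] []].
apply: filterS (filterI (filterI (filterI wU wZ) wH) (filterI (nearl _ ZM) (nearl _ US))).
move=> [s k] /= [[[a1 a2] a3] [ZsM UsS]].
apply: le_lt_trans (lagP_le (VZ s) (HU s) (VH s) UsS (b k) ZsM) _.
have d1 : d <= 1 by rewrite ge_min lexx.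
have dC : d * C <= e by rewrite -ler_pdivlMr// ge_min lexx orbT.
have := wn_ge0 (b k) (U s); have := wn_ge0 (b k) (Z' s); have := wn_ge0 (b k) (H' s).
move: a1 a2 a3; rewrite -/(Z s) -/(Z' s) -/(H' s).
set u := wn _ (U s); set z := wn _ (Z' s); set w := wn _ (H' s) => a1 a2 a3 w0 z0 u0.
have uz : u ^+ 2 + S * (u * z) + 2 * w <= d * (3 + S).
  have : u ^+ 2 <= d by nra.
  have : S * (u * z) <= S * d by rewrite ler_wpM2l//; nra.
  by lra.
have : expR (2 * M) * (u ^+ 2 + S * (u * z) + 2 * w) <= d * C.
  have -> : d * C = expR (2 * M) * (d * (3 + S)) by rewrite /C mulrCA.
  by rewrite ler_wpM2l ?expR_ge0.
by have := expR_ge0 (2 * M); lra.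
Unshelve. all: by end_near. Qed.

End Decay.

Lemma energy_total_cvg s t :
  (H t k%:R - H t (- k%:R)) - (H s k%:R - H s (- k%:R)) @[k --> \oo] --> 0.
Proof.
pose G t xi := U t xi ^+ 3 - 2 * P t xi * U t xi.
apply: (@cvg_uniform_derive _ (fun k t => H t k%:R - H t (- k%:R))
  (fun k t => G t k%:R - G t (- k%:R))) => [k r|r e e0].
  by apply: is_deriveB; exact: (derivative_inV_is_derive (dH r)).
have small (b : nat -> R) (bk : forall k, `|b k| = k%:R) :
    \forall s \near r & k \near \oo, `|G s (b k)| < e / 2.
  set d := Num.min 1 (e / 6).
  have d0 : 0 < d by rewrite lt_min ltr01 divr_gt0.
  have sU := velocity_locally_small bk r d0.
  have sP := pressure_locally_small bk r (@ltr01 R).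
  apply: filterS2 sU sP => -[s' k] /= Us Ps.
  have d1 : d <= 1 by rewrite ge_min lexx.
  have de : d <= e / 6 by rewrite ge_min lexx orbT.
  rewrite /G; move: (U s' (b k)) (P s' (b k)) Us Ps => U0 P0.
  move=> ud p1; apply: le_lt_trans (ler_normB _ _) _.
  rewrite normrX !normrM (ger0_norm (_ : 0 <= 2))//.
  have := normr_ge0 U0; have := normr_ge0 P0.
  move: ud p1; move: `|U0| `|P0| => u p ud p1 p0 u0.
  have : u ^+ 3 <= u by rewrite exprS ler_piMr// expr2; nra.
  have : p * u <= u by rewrite ler_piMl// ltW.
  have -> : 2 * p * u = 2 * (p * u) by ring.
  by lra.
have s1 := small (fun k => k%:R) (fun k => ger0_norm (ler0n _ k)).
have s2 := small (fun k => - k%:R) (fun k => etrans (normrN _) (ger0_norm (ler0n _ k))).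
apply: filterS2 s1 s2 => -[s' k] /= a b.
by apply: le_lt_trans (ler_normB _ _) _; rewrite [e]splitr ltrD.
Qed.

Lemma momentum_cvg s t :
  \int[leb]_(xi in `[- k%:R, k%:R]) (U t xi * (1 + Z' t xi)) -
  \int[leb]_(xi in `[- k%:R, k%:R]) (U s xi * (1 + Z' s xi))
  @[k --> \oo] --> 0.
Proof.
pose G t xi := - P t xi + U t xi ^+ 2 / 2.
apply: (@cvg_uniform_derive _
  (fun k t => \int[leb]_(xi in `[- k%:R, k%:R]) (U t xi * (1 + Z' t xi)))
  (fun k t => G t k%:R - G t (- k%:R))) => [k r|r e e0].
  pose Y s xi : R := Z' s xi + \1_`[- k%:R, k%:R]%classic xi.
  have Y2 q : inL2 (Y q) by apply: inL2D => //; exact: inL2_indic_itv.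
  have dY : L2_derivative Y r (U' r).
    have := derivative_inV_L2 VZ (dZ r); rewrite /L2_derivative.
    have -> // : (fun h => n2 (fun xi => h^-1 * (Y (r + h) xi - Y r xi) - U' r xi)) =
      (fun h => n2 (fun xi => h^-1 * (Z' (r + h) xi - Z' r xi) - U' r xi)).
    apply/funext => h; congr n2; apply/funext => xi; rewrite /Y; congr (_ * _ - _).
    by ring.
  have [[_ Q2 _] _] := dU r.
  have mD : measurable (`[- k%:R, k%:R]%classic : set R) by exact: measurable_itv.
  have := is_derive_L2_inner mD U2 Y2 Q2 (U'2 r) (derivative_inH1_L2 (dU r)) dY.
  have YE q xi : xi \in (`[- k%:R, k%:R]%classic : set R) -> Y q xi = 1 + Z' q xi.
    by move=> xk; rewrite /Y indicE xk addrC.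
  have -> : (fun q => \int[leb]_(xi in `[- k%:R, k%:R]) (U q xi * Y q xi)) =
      (fun q => \int[leb]_(xi in `[- k%:R, k%:R]) (U q xi * (1 + Z' q xi))).
    by apply/funext => q; apply: eq_Rintegral => xi /YE ->.
  have kk : - k%:R <= k%:R :> R by rewrite ge0_cp.
  have [_ /(_ _ _ kk) eU] := primitive_sqr (inH1_primitive (HU r)).
  have [_ /(_ _ _ kk) eP] := primitive_lagP (VZ r) (HU r) (VH r).
  move=> dA; apply: is_derive_eq dA _.
  have -> : \int[leb]_(xi in `[- k%:R, k%:R]) (- Q r xi * Y r xi) =
      -1 * \int[leb]_(xi in `[- k%:R, k%:R]) (Q r xi * (1 + Z' r xi)).
    rewrite -RintegralZl//.
      by apply: eq_Rintegral => xi /YE ->; ring.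
    by have [l _] := primitive_lagP (VZ r) (HU r) (VH r); exact: locally_integrable_itv.
  rewrite -eP.
  have -> : \int[leb]_(xi in `[- k%:R, k%:R]) (U r xi * U' r xi) =
      2^-1 * \int[leb]_(xi in `[- k%:R, k%:R]) (2 * U r xi * derive1 (U r) xi).
    rewrite -RintegralZl//.
      by apply: eq_Rintegral => xi _; rewrite /U'; field.
    by have [l _] := primitive_sqr (inH1_primitive (HU r)); exact: locally_integrable_itv.
  by rewrite -eU /G /P; field.
have small (b : nat -> R) (bk : forall k, `|b k| = k%:R) :
    \forall s \near r & k \near \oo, `|G s (b k)| < e / 2.
  set d := Num.min 1 (e / 4).
  have e4 : 0 < e / 4 by rewrite divr_gt0.
  have d0 : 0 < d by rewrite lt_min ltr01.
  have sU := velocity_locally_small bk r d0.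
  have sP := pressure_locally_small bk r e4.
  apply: filterS2 sU sP => -[s' k] /= Us Ps.
  have d1 : d <= 1 by rewrite ge_min lexx.
  have de : d <= e / 4 by rewrite ge_min lexx orbT.
  rewrite /G; move: (U s' (b k)) (P s' (b k)) Us Ps => U0 P0.
  move=> ud p1; apply: le_lt_trans (ler_normD _ _) _.
  rewrite normrN normrM normrX (ger0_norm (_ : 0 <= 2^-1)) ?invr_ge0//.
  have := normr_ge0 U0.
  move: ud p1; move: `|U0| `|P0| => u p ud p1 u0.
  have : u ^+ 2 <= u by rewrite expr2; nra.
  by lra.
have s1 := small (fun k => k%:R) (fun k => ger0_norm (ler0n _ k)).
have s2 := small (fun k => - k%:R) (fun k => etrans (normrN _) (ger0_norm (ler0n _ k))).
apply: filterS2 s1 s2 => -[s' k] /= a b.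
by apply: le_lt_trans (ler_normB _ _) _; rewrite [e]splitr ltrD.
Qed.

End Dynamics.

(** * Multi-peakons *)

Section Atoms.
Context {R : realType} (N : nat) (x w : 'I_N -> R).
Hypothesis x_inj : injective x.
Notation leb := (@lebesgue_measure R).

Let D : set R := \big[setU/set0]_(i < N) [set x i].

Let mD : measurable (D : set (measurableTypeR R)).
Proof. by apply: bigsetU_measurable => i _; exact: measurable_set1. Qed.

Let memD i : D (x i).
Proof. by rewrite /D (bigD1 i)//=; left. Qed.

Lemma integral_atoms (m : {measure set (measurableTypeR R) -> \bar R}) (f : R -> R) :
  measurable_fun setT f -> m (~` D) = 0%E ->
  (\int[m]_t (f t)%:E = \sum_(i < N) (f (x i))%:E * m [set x i])%E.
Proof.
move=> mf mD0.
have -> : (\int[m]_t (f t)%:E = \int[m]_(t in D) (f t)%:E)%E.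
  rewrite [RHS]integral_mkcond; apply: ae_eq_integral => //.
  - exact/measurable_EFinP.
  - apply/(measurable_restrictT _ _).1 => //; apply/measurable_EFinP.
    exact: measurable_funTS.
  - exists (~` D); split => //; first exact: measurableC.
    move=> t /=; apply: contra_notP => /contrapT Dt _.
    by rewrite patchE mem_set.
rewrite integral_bigsetU_EFin//=.
- apply: eq_bigr => i _.
  rewrite -integral_cst//; apply: eq_integral => t.
  by rewrite inE /= => ->.
- exact: index_enum_uniq.
- by move=> i j _ _ [t [/= -> /x_inj]].
- by apply/measurable_EFinP; exact: measurable_funTS.
Qed.

Lemma charge_integral_atoms (nu : {charge set (measurableTypeR R) -> \bar R})
    (f : R -> R) : measurable_fun setT f ->
  (forall B : set R, measurable B ->
    nu B = (\sum_(n < N) (w n)%:E * \d_(x n) B)%E) ->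
  charge_integral nu f = \sum_(n < N) w n * f (x n).
Proof.
move=> mf nuE; rewrite /charge_integral.
case: cid => P nuP; case: cid => M nuPM.
have [[mP _] [mM _] PMT PM0] := nuPM.
have nu_cap (A : set R) (B : set R) : measurable A -> measurable B -> A `<=` ~` D ->
    nu (A `&` B) = 0%E.
  move=> mA mB AD; rewrite nuE; last exact: measurableI.
  rewrite big1// => i _; rewrite diracE memNset ?mule0//.
  by move=> [/AD/(_ (memD i))].
have nu_pt i (B : set R) : measurable B ->
    nu ([set x i] `&` B) = (w i * (x i \in B)%:R)%:E.
  move=> mB; rewrite nuE; last by apply: measurableI => //; exact: measurable_set1.
  rewrite (bigD1 i)//= big1 ?adde0.
    rewrite diracE EFinM; suff -> : (x i \in [set x i] `&` B) = (x i \in B) by [].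
    by apply/idP/idP => /set_mem; [case=> _ /mem_set|move=> Bx; apply/mem_set].
  move=> j ji; rewrite diracE memNset ?mule0// => -[/= /x_inj ij _].
  by rewrite ij eqxx in ji.
have mDC : measurable (~` D : set (measurableTypeR R)) by exact: measurableC.
have pos0 : jordan_pos nuPM (~` D) = 0%E.
  by rewrite jordan_posE cjordan_posE /crestr0 mem_set//; exact: nu_cap.
have neg0 : jordan_neg nuPM (~` D) = 0%E.
  by rewrite jordan_negE cjordan_negE /crestr0 mem_set// /crestr nu_cap ?oppe0.
have posx i : jordan_pos nuPM [set x i] = (w i * (x i \in P)%:R)%:E.
  by rewrite jordan_posE cjordan_posE /crestr0 mem_set//; exact: nu_pt.
have negx i : jordan_neg nuPM [set x i] = (- (w i * (x i \in M)%:R))%:E.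
  rewrite jordan_negE cjordan_negE /crestr0 mem_set//.
  by rewrite /crestr (nu_pt _ _ mM).
have int_pos : (\int[jordan_pos nuPM]_t (f t)%:E =
    \sum_(i < N) (f (x i) * (w i * (x i \in P)%:R))%:E)%E.
  rewrite integral_atoms//; apply: eq_bigr => i _.
  by rewrite EFinM; congr (_ * _)%E; exact: posx.
have int_neg : (\int[jordan_neg nuPM]_t (f t)%:E =
    \sum_(i < N) (f (x i) * - (w i * (x i \in M)%:R))%:E)%E.
  rewrite integral_atoms//; apply: eq_bigr => i _.
  by rewrite EFinM; congr (_ * _)%E; exact: negx.
rewrite /Rintegral int_pos int_neg.
rewrite !sumEFin /= -sumrB; apply: eq_bigr => i _.
have : (x i \in P)%:R + (x i \in M)%:R = 1 :> R.
  have : [set: R] (x i) by [].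
  rewrite -PMT => -[] h; rewrite (mem_set h) ?addr0 ?add0r.
    by rewrite memNset ?addr0// => hM; rewrite -[False]/((set0 : set R) (x i)) -PM0.
  by rewrite memNset ?add0r// => hP; rewrite -[False]/((set0 : set R) (x i)) -PM0.
move=> PM1.
transitivity (w i * f (x i) * ((x i \in P)%:R + (x i \in M)%:R)); first by ring.
by rewrite PM1 mulr1.
Qed.

End Atoms.

Section Peakon.
Context {R : realType} (N : nat) (x w : 'I_N -> R) (u : R -> R).
Hypothesis uE : forall z, u z = 2^-1 * \sum_(n < N) w n * expR (- `|z - x n|).
Notation leb := (@lebesgue_measure R).

Let e n z := expR (- `|z - x n|).
Let s n z := Num.sg (z - x n).
Let v z := 2^-1 * \sum_(n < N) w n * (- s n z * e n z).

Let primitive_u : primitive u v.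
Proof.
have -> : u = (fun z => 2^-1 * \sum_(n < N) w n * e n z) by apply/funext.
apply: primitiveZ; apply: primitive_sum => n; apply: primitiveZ.
exact: primitive_peakon.
Qed.

Lemma multipeakon_continuous : continuous u.
Proof. exact: primitive_continuous primitive_u. Qed.

Lemma peakon_cvgy (a : R) : expR (- `|z - a|) @[z --> +oo] --> 0.
Proof.
have : expR a * expR (- z) @[z --> +oo] --> expR a * 0.
  by apply: cvgM; [exact: cvg_cst|exact: cvgr_expR].
rewrite mulr0; apply: cvg_trans; apply: near_eq_cvg.
near=> z; rewrite -expRD; congr expR.
have : a <= z by near: z; apply: nbhs_pinfty_ge; rewrite num_real.
by rewrite -subr_ge0 => /ger0_norm ->; ring.
Unshelve. all: by end_near. Qed.

Lemma peakon_cvgNy (a : R) : expR (- `|z - a|) @[z --> -oo] --> 0.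
Proof.
apply/cvgNy_compNP.
have -> : (fun z => expR (- `|z - a|)) \o -%R = (fun z => expR (- `|z - (- a)|)).
  apply/funext => z /=; congr (expR (- _)).
  by rewrite -[LHS]normrN; congr `|_|; ring.
exact: peakon_cvgy.
Qed.

Lemma sg_cvgy (a : R) : Num.sg (z - a) @[z --> +oo] --> (1 : R).
Proof.
apply: cvg_near_cst; near=> z.
by rewrite gtr0_sg// subr_gt0; near: z; apply: nbhs_pinfty_gt; rewrite num_real.
Unshelve. all: by end_near. Qed.

Lemma sg_cvgNy (a : R) : Num.sg (z - a) @[z --> -oo] --> (-1 : R).
Proof.
apply: cvg_near_cst; near=> z.
by rewrite ltr0_sg// subr_lt0; near: z; apply: nbhs_ninfty_lt; rewrite num_real.
Unshelve. all: by end_near. Qed.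

Let F z := 2^-1 * \sum_(n < N) w n * (s n z * (1 - e n z)).
Let E z := - (2^-1 * \sum_(n < N) w n * (s n z * (e n z * u z - u (x n)))).

Section Ends.
Variables (FF : set_system R) (c : R).
Context {FFF : Filter FF}.
Hypothesis e_cvg : forall a : R, expR (- `|z - a|) @[z --> FF] --> 0.
Hypothesis s_cvg : forall a : R, Num.sg (z - a) @[z --> FF] --> c.

Let cvg_wsum (f : 'I_N -> R -> R) (l : 'I_N -> R) :
  (forall n, f n @ FF --> l n) ->
  2^-1 * \sum_(n < N) w n * f n z @[z --> FF] --> 2^-1 * \sum_(n < N) w n * l n.
Proof.
move=> fl; apply: cvgM; first exact: cvg_cst.
apply: (@cvg_big _ _ +%R 0 xpredT (@add_continuous R)) => n _.
by apply: cvgM; [exact: cvg_cst|exact: fl].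
Qed.

Lemma multipeakon_int_end : F @ FF --> 2^-1 * \sum_(n < N) w n * c.
Proof.
apply: cvg_wsum => n; have -> : c = c * (1 - 0) by ring.
apply: cvgM; first exact: s_cvg.
by apply: cvgB; [exact: cvg_cst|exact: e_cvg].
Qed.

Let u_cvg : u @ FF --> 0.
Proof.
have -> : u = (fun z => 2^-1 * \sum_(n < N) w n * e n z) by apply/funext.
rewrite [X in _ --> X](_ : 0 = 2^-1 * \sum_(n < N) w n * 0); last first.
  by rewrite big1 ?mulr0// => n _; rewrite mulr0.
exact: (@cvg_wsum e (fun=> 0) (fun n => e_cvg (x n))).
Qed.

Lemma multipeakon_energy_end : E @ FF --> c * (2^-1 * \sum_(n < N) w n * u (x n)).
Proof.
have -> : c * (2^-1 * \sum_(n < N) w n * u (x n)) =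
    - (2^-1 * \sum_(n < N) w n * (c * (0 * 0 - u (x n)))).
  rewrite mulrCA mulr_sumr -mulrN -sumrN; congr (_ * _).
  by apply: eq_bigr => n _; ring.
have cE := @cvg_wsum (fun n z => s n z * (e n z * u z - u (x n)))
  (fun n => c * (0 * 0 - u (x n))) _.
apply: cvgN; apply: cE => n; apply: cvgM; first exact: s_cvg.
apply: cvgB; last exact: cvg_cst.
by apply: cvgM; [exact: e_cvg|exact: u_cvg].
Qed.

End Ends.

Lemma multipeakon_antiderivative : exists G : R -> R,
  [/\ forall z : R, is_derive z 1 G (u z),
      G @ +oo --> 2^-1 * \sum_(n < N) w n &
      G @ -oo --> - (2^-1 * \sum_(n < N) w n)].
Proof.
exists F; split.
- move=> z; apply: primitive_is_derive_continuous multipeakon_continuous.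
  have -> : u = (fun z => 2^-1 * \sum_(n < N) w n * e n z) by apply/funext.
  apply: primitiveZ; apply: primitive_sum => n; apply: primitiveZ.
  exact: primitive_int_peakon.
- have -> : \sum_(n < N) w n = \sum_(n < N) w n * 1.
    by apply: eq_bigr => n _; rewrite mulr1.
  exact: multipeakon_int_end peakon_cvgy sg_cvgy.
- have -> : - (2^-1 * \sum_(n < N) w n) = 2^-1 * \sum_(n < N) w n * -1.
    by rewrite -mulrN -sumrN; congr (_ * _); apply: eq_bigr => n _; rewrite mulrN1.
  exact: multipeakon_int_end peakon_cvgNy sg_cvgNy.
Qed.

Let primitive_E : primitive E (fun z => u z ^+ 2 + v z ^+ 2).
Proof.
have mv : measurable_fun setT v by case: primitive_u => -[].
have cu := multipeakon_continuous.
have term n : primitive (fun z => s n z * (e n z * u z - u (x n)))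
    (fun z => - (e n z * u z) + s n z * e n z * v z).
  have p := primitive_sg (x n) (primitiveM (primitive_peakon (x n)) primitive_u).
  have {}p : primitive (fun z => s n z * (e n z * u z - u (x n)))
      (fun z => s n z * (- s n z * e n z * u z + e n z * v z)).
    by move: p; rewrite subrr normr0 oppr0 expR0 mul1r.
  have me : measurable_fun setT (e n).
    apply: continuous_measurable_fun; exact: primitive_continuous (primitive_peakon (x n)).
  apply: (primitive_eq_deriv p).
    apply: measurable_funD.
      apply: measurableT_comp => //; apply: measurable_funM => //.
      exact: continuous_measurable_fun.
    apply: measurable_funM => //; apply: measurable_funM => //.
    exact: measurable_sg.
  apply: aeS (ae_neq (x n)) => z /= /eqP zx.
  have s1 : s n z ^+ 2 = 1 by rewrite sqr_sg subr_eq0 zx.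
  transitivity (- (s n z ^+ 2 * (e n z * u z)) + s n z * e n z * v z); first by ring.
  by rewrite s1 mul1r.
have := primitiveZ (-1) (primitiveZ 2^-1 (primitive_sum (index_enum 'I_N)
  (fun n => primitiveZ (w n) (term n)))).
congr primitive; apply/funext => z; first by rewrite mulN1r.
have -> : u z ^+ 2 + v z ^+ 2 =
    2^-1 * ((\sum_(n < N) w n * e n z) * u z +
            (\sum_(n < N) w n * (- s n z * e n z)) * v z).
  by rewrite uE /v; ring.
rewrite mulN1r -mulrN -sumrN 2!mulr_suml -big_split/=; congr (_ * _).
by apply: eq_bigr => n _; ring.
Qed.

Lemma multipeakon_energy :
  (\int[leb]_z (`|u z| ^+ 2 + `|derive1 u z| ^+ 2)%:E =
   (\sum_(n < N) w n * u (x n))%:E)%E.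
Proof.
have -> : (\int[leb]_z (`|u z| ^+ 2 + `|derive1 u z| ^+ 2)%:E =
    \int[leb]_z (u z ^+ 2 + v z ^+ 2)%:E)%E.
  apply: ge0_ae_eq_integralT => [z|z|].
  - by rewrite lee_fin addr_ge0// exprn_ge0.
  - by rewrite lee_fin addr_ge0// sqr_ge0.
  - apply: aeS (primitive_derive1 primitive_u) => z /= ->.
    by rewrite !real_normK ?num_real.
have [lE EE] := primitive_E.
have cE : (\int[leb]_(z in `[(- k%:R)%R, k%:R%R]) (u z ^+ 2 + v z ^+ 2)%:E
    @[k --> \oo] --> (\sum_(n < N) w n * u (x n))%:E)%E.
  have -> : (fun k : nat => (\int[leb]_(z in `[(- k%:R)%R, k%:R%R])
      (u z ^+ 2 + v z ^+ 2)%:E)%E) = (fun k => (E k%:R - E (- k%:R))%:E).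
    apply/funext => k; rewrite EE ?ge0_cp// /Rintegral fineK//.
    by apply: integrable_fin_num => //; exact: locally_integrable_itv.
  apply: cvg_EFin; first exact: nearW.
  have -> : \sum_(n < N) w n * u (x n) =
      1 * (2^-1 * \sum_(n < N) w n * u (x n)) -
      -1 * (2^-1 * \sum_(n < N) w n * u (x n)) by field.
  apply: cvgB.
    exact: (cvg_comp _ _ (@cvgr_idn R) (multipeakon_energy_end peakon_cvgy sg_cvgy)).
  have cN : (- k%:R : R) @[k --> \oo] --> -oo.
    by apply/cvgNrNy; exact: cvgr_idn.
  exact: (cvg_comp _ _ cN (multipeakon_energy_end peakon_cvgNy sg_cvgNy)).
have := ge0_cvg_itvNn (_ : measurable_fun setT (fun z => u z ^+ 2 + v z ^+ 2)) _.
move=> /(_ _ _)/cvg_unique; apply => //.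
- by case: lE.
- by move=> z; rewrite addr_ge0// sqr_ge0.
Qed.

End Peakon.

Section Flow.
Context {R : realType}.
Notation leb := (@lebesgue_measure R).
Notation borel_measure := {finite_measure set (measurableTypeR R) -> \bar R}.

Lemma pushforward_mass_cvg (y H : R -> R) (mu : borel_measure) : inV H ->
  (forall B : set R, measurable B ->
    mu B = (\int[leb]_(xi in y @^-1` B) (derive1 H xi)%:E)%E) ->
  H k%:R - H (- k%:R) @[k --> \oo] --> fine (mu setT).
Proof.
move=> VH muE.
have mH : measurable_fun setT (derive1 H) by exact: inL2_measurable (inV_L2 VH).
have muT := muE _ measurableT; rewrite preimage_setT in muT.
rewrite muT; apply: (primitive_cvg _ (inV_primitive VH)).
apply/integrableP; split; first exact/measurable_EFinP.
rewrite integral_fin_num_abs// -muT; exact: fin_num_measure.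
Qed.

Lemma char_cvgy (y : R -> R) : inV (fun x => y x - x) -> y k%:R @[k --> \oo] --> +oo.
Proof.
move=> [_ [M yM] _ _]; apply/cvgryPge => A; near=> k.
have : A + M <= k%:R by near: k; exact: nbhs_infty_ger.
by have := yM k%:R; rewrite ler_norml => /andP[? _]; lra.
Unshelve. all: by end_near. Qed.

Lemma char_cvgNy (y : R -> R) : inV (fun x => y x - x) -> y (- k%:R) @[k --> \oo] --> -oo.
Proof.
move=> [_ [M yM] _ _]; apply/cvgrNyPle => A; near=> k.
have : M - A <= k%:R by near: k; exact: nbhs_infty_ger.
by have := yM (- k%:R); rewrite ler_norml => /andP[_ ?]; lra.
Unshelve. all: by end_near. Qed.

Lemma multipeakon_momentum_cvg (N : nat) (x w : 'I_N -> R) (u y U : R -> R) :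
  (forall z, u z = 2^-1 * \sum_(n < N) w n * expR (- `|z - x n|)) ->
  inV (fun x => y x - x) -> (forall xi, u (y xi) = U xi) ->
  \int[leb]_(xi in `[- k%:R, k%:R]) (U xi * (1 + derive1 (fun x => y x - x) xi))
    @[k --> \oo] --> \sum_(n < N) w n.
Proof.
move=> uE Vy uy.
have [G [dG Gy GNy]] := multipeakon_antiderivative uE.
have [_ p] := primitive_comp dG (multipeakon_continuous uE) (primitive_char Vy).
have -> : (fun k : nat => \int[leb]_(xi in `[- k%:R, k%:R])
    (U xi * (1 + derive1 (fun x => y x - x) xi))) =
    (fun k => G (y k%:R) - G (y (- k%:R))).
  apply/funext => k; rewrite p ?ge0_cp//; apply: eq_Rintegral => xi _.
  by rewrite uy.
have -> : \sum_(n < N) w n =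
    2^-1 * (\sum_(n < N) w n) - - (2^-1 * (\sum_(n < N) w n)) by field.
apply: cvgB.
  exact: (cvg_comp _ _ (char_cvgy Vy) Gy).
exact: (cvg_comp _ _ (char_cvgNy Vy) GNy).
Qed.

Lemma cvg_sub_unique (a b : nat -> R) (l m : R) :
  a @ \oo --> l -> b @ \oo --> m -> a k - b k @[k --> \oo] --> 0 -> m = l.
Proof.
move=> al bm ab; apply/esym/eqP; rewrite -subr_eq0; apply/eqP.
exact: (cvg_unique _ (cvgB al bm) ab).
Qed.

End Flow.

Unset Implicit Arguments.

Theorem corollary5p3 (R : realType) (N : R -> nat)
    (x w v : forall t : R, 'I_(N t) -> R)
    (x_incr : forall t (i j : 'I_(N t)), (i < j)%N -> x t i < x t j)
    (v_ge0 : forall t (n : 'I_(N t)), 0 <= v t n)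
    (wv_gt0 : forall t (n : 'I_(N t)), 0 < `|w t n| + v t n)
    (omega : R -> {charge set (measurableTypeR R) -> \bar R})
    (omegaE : forall t (B : set R), measurable B ->
       omega t B = (\sum_(n < N t) (w t n)%:E * \d_(x t n) B)%E)
    (upsilon : R -> {measure set (measurableTypeR R) -> \bar R})
    (upsilonE : forall t (B : set R), measurable B ->
       upsilon t B = (\sum_(n < N t) (v t n)%:E * \d_(x t n) B)%E)
    (u : R -> R -> R)
    (uE : forall t z, u t z =
       2^-1 * charge_integral (omega t) (fun s => expR (- `|z - s|)))
    (mu : R -> {finite_measure set (measurableTypeR R) -> \bar R})
    (muE : forall t (B : set R), measurable B ->
       mu t B = (upsilon t B +
         \int[@lebesgue_measure R]_(z in B)
           (`|u t z| ^+ 2 + `|derive1 (u t) z| ^+ 2)%:E)%E) :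
  global_conservative u mu -> multi_peakon u mu ->
  (forall s t, charge_integral (omega s) (cst 1) =
               charge_integral (omega t) (cst 1)) /\
  (forall s t,
     charge_integral (omega s) (u s) + \int[upsilon s]_z 1 =
     charge_integral (omega t) (u t) + \int[upsilon t]_z 1).
Proof.
move=> [_ flowP] _.
have x_inj t : injective (x t).
  move=> i j xij; apply/val_inj.
  by case: (ltngtP i j) => // /x_incr; rewrite xij ltxx.
have omega_int t f : measurable_fun setT f ->
    charge_integral (omega t) f = \sum_(n < N t) w t n * f (x t n).
  by move=> mf; exact: (charge_integral_atoms (x_inj t) mf (omegaE t)).
have u_sum t z : u t z = 2^-1 * \sum_(n < N t) w t n * expR (- `|z - x t n|).
  rewrite uE omega_int//; have := measurable_fun_expR_dist z (-1).
  by congr measurable_fun; apply/funext => s; rewrite mulN1r.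
have I1 t : charge_integral (omega t) (cst 1) = \sum_(n < N t) w t n.
  by rewrite omega_int//; apply: eq_bigr => n _; rewrite mulr1.
have I2 t : charge_integral (omega t) (u t) + \int[upsilon t]_z 1 = fine (mu t setT).
  rewrite omega_int; last first.
    by apply: continuous_measurable_fun; exact: multipeakon_continuous (u_sum t).
  have muT := muE t _ measurableT; rewrite (multipeakon_energy (u_sum t)) in muT.
  have : mu t setT \is a fin_num by exact: fin_num_measure.
  rewrite muT fin_numD => /andP[ups _].
  by rewrite fineD//= Rintegral_cst// mul1r addrC.
have conserved s t : \sum_(n < N s) w s n = \sum_(n < N t) w t n /\
    fine (mu s setT) = fine (mu t setT).
  have [y [U [H [sol init uy muH]]]] := flowP s t.
  have [y0 [U0 [H0 [_ init0 uy0 muH0]]]] := flowP s s.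
  have {}init : [/\ y0 0 = y 0, U0 0 = U 0 & H0 0 = H 0].
    by split; apply/funext => xi; have [yi Ui Hi] := init xi;
      have [yi0 Ui0 Hi0] := init0 xi; rewrite ?yi0 ?Ui0 ?Hi0 ?yi ?Ui ?Hi.
  have [yE UE HE] := init.
  move: uy0 muH0; rewrite subrr yE UE HE => uy0 muH0.
  have [[Z0 _ V0] _] := sol 0.
  have [[Zt _ Vt] _] := sol (t - s).
  split.
    exact: cvg_sub_unique (multipeakon_momentum_cvg (u_sum t) Zt uy)
      (multipeakon_momentum_cvg (u_sum s) Z0 uy0) (momentum_cvg sol 0 (t - s)).
  exact: cvg_sub_unique (pushforward_mass_cvg Vt muH)
    (pushforward_mass_cvg V0 muH0) (energy_total_cvg sol 0 (t - s)).
split=> s t; first by rewrite !I1; case: (conserved s t).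
by rewrite !I2; case: (conserved s t).
Qed.
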